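(* Let $\epsilon>0$ and $L_f>0$ be given. Suppose an algorithm is applied to problem (SP) that satisfies Assumption 1(a),(c) and $\inf_{x,y}F(x,y)>-\infty$. Suppose the generated sequence $\{(x^{(t)},y^{(t)})\}_{t\ge0}$ satisfies Assumption 3. Then there exists an instance of problem (SP), namely the reformulation (SP) of instance $\mathcal P$, such that the algorithm requires at least $$\left\lceil\frac{\kappa([\bar A;A])\,L_f\,\Delta_F}{72000\pi^2}\,\epsilon^{-2}\right\rceil$$ oracles to obtain an $\epsilon$-stationary point of that instance, where $\Delta_F=F(x^{(0)},y^{(0)})-\inf_{x,y}F(x,y)$.
   Context: **Problem (SP).** $\min_{x\in\mathbb R^d,y\in\mathbb R^{\bar n}}F(x,y):=f_0(x)+\bar g(y)$ s.t. $Ax+b=0$, $y=\bar Ax+\bar b$, with $A\in\mathbb R^{n\times d}$, $b\in\mathbb R^n$, $\bar A\in\mathbb R^{\bar n\times d}$, $\bar b\in\mathbb R^{\bar n}$, $f_0$ smooth. It is the splitting reformulation of problem (P): $\min_xf_0(x)+g(x)$ s.t. $Ax+b=0$, with $g(x)=\bar g(\bar Ax+\bar b)$. **Assumption 1(a),(c).** (a) $\nabla f_0$ is $L_f$-Lipschitz continuous; (c) $g(x)=\bar g(\bar Ax+\bar b)$ with $\bar g:\mathbb R^{\bar n}\to\mathbb R\cup\{+\infty\}$ proper lower semicontinuous convex, potentially non-smooth. **$\epsilon$-stationary point of (SP).** $(x^*,y^* )$ such that for some $z_1\in\mathbb R^{\bar n},z_2\in\mathbb R^n$: $\max\{\mathrm{dist}(0,\partial\bar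 g(y^* )-z_1),\|\nabla f_0(x^* )+\bar A^\top z_1+A^\top z_2\|,\|y^*-\bar Ax^*-\bar b\|,\|Ax^*+b\|\}\le\epsilon$. **Assumption 3 (linear span).** There is an oracle that, given any $x\in\mathbb R^d$ and $y,\xi\in\mathbb R^{\bar n}$, returns $(\bar b,A^\top b,\bar A^\top\bar b)$, $(\nabla f_0(x),\bar Ax,A^\top Ax,\bar A^\top\bar Ax,\bar A^\top y)$ and $\mathrm{prox}_{\eta\bar g}(\xi)$ for any $\eta>0$, where $\mathrm{prox}_{\eta\bar g}(y)=\arg\min_{y'}\{\bar g(y')+\frac1{2\eta}\|y'-y\|^2\}$. The sequence generated by the algorithm satisfies, for all $t\ge1$: $x^{(t)}\in\mathrm{span}\big(\{A^\top b,\bar A^\top\bar b\}\cup\bigcup_{s=0}^{t-1}\{x^{(s)},\nabla f_0(x^{(s)}),A^\top Ax^{(s)},\bar A^\top\bar Ax^{(s)},\bar A^\top y^{(s)}\}\big)$ and $y^{(t)}\in\mathrm{span}(\{\xi^{(t)},\zeta^{(t)}\})$, where $\xi^{(t)}\in\mathrm{span}\big(\{\bar b\}\cup\bigcup_{s=0}^{t-1}\{y^{(s)},\bar A\bar A^\top y^{(s)},\bar Ax^{(s)}\}\big)$ and $\zeta^{(t)}\in\{\mathrm{prox}_{\eta\bar g}(\xi^{(t)}):\eta>0\}$. The point $(x^{(t)},y^{(t)})$ is generated by the $t$-th iteration, and each iteration calls the oracle once. **Condition number.** $[\bar A;A]$ is the vertical stacking; $\kappa(M)=\sqrt{\lambda_{\max}(MM^\top)/\lambda_{\min}(MM^\top)}$,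 where $\lambda_{\max}$ is the largest and $\lambda_{\min}$ the smallest positive eigenvalue. **Instance $\mathcal P$ (of problem (P)).** Parameters $\epsilon$ and $L_f>0$; integers $m_1\ge2$ even, $m_2\ge1$, $\bar d\ge5$ odd. Put $m=3m_1m_2$, $d=m\bar d$, $\mathcal M=\{im_1:i=1,\dots,3m_2-1\}$, $\mathcal M^C=\{1,\dots,m-1\}\setminus\mathcal M$, $n=(m-3m_2)\bar d$, $\bar n=(3m_2-1)\bar d$. Write $x=(x_1^\top,\dots,x_m^\top)^\top\in\mathbb R^d$, $x_i\in\mathbb R^{\bar d}$. $J_m\in\mathbb R^{(m-1)\times m}$ has $(J_m)_{i,i}=-1$, $(J_m)_{i,i+1}=1$, other entries $0$; $J_{\mathcal M},J_{\mathcal M^C}$ are its rows indexed by $\mathcal M,\mathcal M^C$. $\bar A=mL_fJ_{\mathcal M}\otimes I_{\bar d}$, $A=mL_fJ_{\mathcal M^C}\otimes I_{\bar d}$, $b=0$, $\bar b=0$. $\bar g(y)=\frac{\beta}{mL_f}\|y\|_1$, $g(x)=\bar g(\bar Ax)=\beta\sum_{i\in\mathcal M}\|x_i-x_{i+1}\|_1$, with $\beta$ a constant satisfying $\beta>(50\pi+1+\|A\|)\sqrt m\,\epsilon$. $\Psi(u)=0$ for $u\le0$, $\Psi(u)=1-e^{-u^2}$ for $u>0$; $\Phi(v)=4\arctan v+2\pi$. For $z\in\mathbb R^{\bar d}$: $\varphi(z,1)=-\Psi(1)\Phi([z]_1)$; $\varphi(z,j)=\Psi(-[z]_{j-1})\Phi(-[z]_j)-\Psi([z]_{j-1})\Phi([z]_j)$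 for $j=2,\dots,\bar d$, where $[z]_j$ is the $j$-th coordinate. $h_i(z)=\varphi(z,1)+3\sum_{j=1}^{\lfloor\bar d/2\rfloor}\varphi(z,2j)$ for $1\le i\le\frac m3$; $h_i(z)=\varphi(z,1)$ for $\frac m3+1\le i\le\frac{2m}3$; $h_i(z)=\varphi(z,1)+3\sum_{j=1}^{\lfloor\bar d/2\rfloor}\varphi(z,2j+1)$ for $\frac{2m}3+1\le i\le m$. $f_i(z)=\frac{300\pi\epsilon^2}{mL_f}h_i\big(\frac{\sqrt mL_fz}{150\pi\epsilon}\big)$ and $f_0(x)=\sum_{i=1}^mf_i(x_i)$. **Convention on the starting point.** The starting point $(x^{(0)},y^{(0)})$ is arbitrary. The instance is written for $(x^{(0)},y^{(0)})=(0,0)$, which is assumed without loss of generality; otherwise the instance is translated by the corresponding change of variables. *)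

(* Defs.v *)
From HB Require Import structures.
From mathcomp Require Import all_boot all_order all_algebra.
From mathcomp Require Import mxtens zify.
From mathcomp Require Import all_classical all_reals all_analysis.

Set Implicit Arguments.
Unset Strict Implicit.
Unset Printing Implicit Defensive.

Import Order.TTheory GRing.Theory Num.Theory.
Import numFieldNormedType.Exports.

Local Open Scope classical_set_scope.
Local Open Scope ring_scope.

Section Euclidean.
Context {R : realType}.

Definition dot n (u v : 'cV[R]_n) : R := \sum_(i < n) u i 0 * v i 0.

(* The library norm `|v| on matrices is the maximum norm. *)
Definition norm2 n (v : 'cV[R]_n) : R := Num.sqrt (\sum_(i < n) v i 0 ^+ 2).

Definition norm1 n (v : 'cV[R]_n) : R := \sum_(i < n) `|v i 0|.

Definition opnorm m n (M : 'M[R]_(m, n)) : R :=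
  sup [set norm2 (M *m v) | v in [set v : 'cV[R]_n | norm2 v <= 1]].

Definition grad n (f : 'cV[R]_n -> R) (x : 'cV[R]_n) : 'cV[R]_n :=
  \col_(i < n) 'D_(delta_mx i 0) f x.

Definition lambda_max n (M : 'M[R]_n) : R := sup [set a | eigenvalue M a].

(* the smallest positive eigenvalue *)
Definition lambda_min n (M : 'M[R]_n) : R :=
  inf [set a | eigenvalue M a /\ 0 < a].

Definition kappa m n (M : 'M[R]_(m, n)) : R :=
  Num.sqrt (lambda_max (M *m M^T) / lambda_min (M *m M^T)).

End Euclidean.

Section ConvexAnalysis.
Context {R : realType} (n : nat).
Implicit Types (g : 'cV[R]_n -> \bar R) (x y v : 'cV[R]_n).

Definition proper g : Prop :=
  (forall y, g y != -oo%E) /\ (exists y, g y != +oo%E).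

Definition econvex g : Prop :=
  forall x y (s : R), 0 <= s <= 1 ->
    (g (s *: x + (1 - s) *: y)%R <= s%:E * g x + (1 - s)%:E * g y)%E.

Definition subdifferential g y : set 'cV[R]_n :=
  [set v | forall y', (g y + (dot v (y' - y))%:E <= g y')%E].

(* The distance from 0 to S; it is +oo when S is empty. *)
Definition dist0 (S : set 'cV[R]_n) : \bar R :=
  ereal_inf [set (norm2 v)%:E | v in S].

Definition prox (eta : R) g y : set 'cV[R]_n :=
  let obj y' := (g y' + ((2 * eta)^-1 * norm2 (y' - y) ^+ 2)%:E)%E in
  [set p | forall y', (obj p <= obj y')%E].

End ConvexAnalysis.

(* Data of the problem: minimise f0 x + gbar y subject to
   A x + b = 0 and y = Abar x + bbar. *)
Record SP (R : realType) (d n nbar : nat) := MkSP {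
  f0 : 'cV[R]_d -> R;
  gbar : 'cV[R]_nbar -> \bar R;
  matA : 'M[R]_(n, d);
  vecb : 'cV[R]_n;
  matAbar : 'M[R]_(nbar, d);
  vecbbar : 'cV[R]_nbar
}.

Section Problem.
Context {R : realType} {d n nbar : nat}.
Implicit Types (P : SP R d n nbar).

Definition objF P (x : 'cV[R]_d) (y : 'cV[R]_nbar) : \bar R :=
  ((f0 P x)%:E + gbar P y)%E.

(* The infimum runs over all (x, y), feasible or not. *)
Definition infF P : \bar R := ereal_inf [set objF P z.1 z.2 | z in setT].

Definition DeltaF P (x : 'cV[R]_d) (y : 'cV[R]_nbar) : R :=
  fine (objF P x y - infF P)%E.

Definition kappaSP P : R := kappa (col_mx (matAbar P) (matA P)).

Definition assumption1ac (Lf : R) P : Prop :=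
  [/\ forall x, differentiable (f0 P) x,
      forall x x', norm2 (grad (f0 P) x - grad (f0 P) x') <= Lf * norm2 (x - x'),
      proper (gbar P),
      lower_semicontinuous (gbar P)
    & econvex (gbar P)].

Definition eps_stationary (eps : R) P (x : 'cV[R]_d) (y : 'cV[R]_nbar) : Prop :=
  exists (z1 : 'cV[R]_nbar) (z2 : 'cV[R]_n),
    [/\ (dist0 [set (v - z1)%R | v in subdifferential (gbar P) y] <= eps%:E)%E,
        norm2 (grad (f0 P) x + (matAbar P)^T *m z1 + (matA P)^T *m z2) <= eps,
        norm2 (y - matAbar P *m x - vecbbar P) <= eps
      & norm2 (matA P *m x + vecb P) <= eps].

(* The linear-span assumption. Each iteration makes one oracle call, so that
   (x t, y t) is available after t calls. *)
Definition assumption3 P (x : nat -> 'cV[R]_d) (y : nat -> 'cV[R]_nbar) : Prop :=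
  forall t : nat, (0 < t)%N ->
    x t \in <<[:: (matA P)^T *m vecb P; (matAbar P)^T *m vecbbar P] ++
              flatten [seq [:: x s; grad (f0 P) (x s);
                               (matA P)^T *m (matA P *m x s);
                               (matAbar P)^T *m (matAbar P *m x s);
                               (matAbar P)^T *m y s] | s <- iota 0 t]>>%VS
    /\ exists xi zeta : 'cV[R]_nbar,
      [/\ xi \in <<vecbbar P ::
                   flatten [seq [:: y s; matAbar P *m ((matAbar P)^T *m y s);
                                    matAbar P *m x s] | s <- iota 0 t]>>%VS,
          exists2 eta : R, 0 < eta & prox eta (gbar P) xi zeta
        & y t \in <<[:: xi; zeta]>>%VS].

(* The change of variables x -> x + u, y -> y + v: the value and the
   constraints of [translate P u v] at (x + u, y + v) are those of P at
   (x, y). *)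
Definition translate P (u : 'cV[R]_d) (v : 'cV[R]_nbar) : SP R d n nbar :=
  MkSP (fun x => f0 P (x - u)) (fun y => gbar P (y - v))
       (matA P) (vecb P - matA P *m u)
       (matAbar P) (vecbbar P + v - matAbar P *m u).

(* The linear-span assumption in coordinates centred at the starting point;
   when x 0 = 0 and y 0 = 0 it is [assumption3 P x y]. Without the centring
   the assumption depends on the choice of the origin. *)
Definition assumption3_from_start P
    (x : nat -> 'cV[R]_d) (y : nat -> 'cV[R]_nbar) : Prop :=
  assumption3 (translate P (- x 0%N) (- y 0%N))
    (fun t => x t - x 0%N) (fun t => y t - y 0%N).

End Problem.

(* An algorithm maps each problem to the sequence of its iterates. *)
Definition algorithm (R : realType) : Type :=
  forall d n nbar : nat,
    SP R d n nbar -> nat -> 'cV[R]_d * 'cV[R]_nbar.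

Section Instance.
Context {R : realType}.
Variables (eps Lf beta : R) (m1 m2 dbar : nat).

Definition mm : nat := (3 * m1 * m2)%N.

(* Rows of J are numbered from 0 here: the index i stands for row i + 1. *)
Definition Jmx : 'M[R]_(mm.-1, mm) :=
  \matrix_(i, j) (if j == i :> nat then -1
                  else if j == i.+1 :> nat then 1 else 0).

Definition setM : {set 'I_mm.-1} :=
  [set i : 'I_mm.-1 | [exists k : 'I_(3 * m2)%N, (0 < k)%N && (i.+1 == k * m1)%N]]%SET.

Definition JM : 'M[R]_(#|setM|, mm) := rowsub (@enum_val _ (mem setM)) Jmx.

Definition JMC : 'M[R]_(#|(~: setM)%SET|, mm) :=
  rowsub (@enum_val _ (mem (~: setM)%SET)) Jmx.

Definition instAbar : 'M[R]_((#|setM| * dbar)%N, (mm * dbar)%N) :=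
  (mm%:R * Lf) *: (JM *t (1%:M : 'M[R]_dbar)).

Definition instA : 'M[R]_((#|(~: setM)%SET| * dbar)%N, (mm * dbar)%N) :=
  (mm%:R * Lf) *: (JMC *t (1%:M : 'M[R]_dbar)).

Definition instgbar (y : 'cV[R]_(#|setM| * dbar)%N) : \bar R :=
  (beta / (mm%:R * Lf) * norm1 y)%:E.

Definition Psi (u : R) : R := if u <= 0 then 0 else 1 - expR (- u ^+ 2).

Definition Phi (v : R) : R := 4 * atan v + 2 * pi.

(* [z]_j with j counted from 1; used only for 1 <= j <= dbar *)
Definition coor (z : 'cV[R]_dbar) (j : nat) : R :=
  if insub j.-1 is Some k then z k 0 else 0.

Definition phi (z : 'cV[R]_dbar) (j : nat) : R :=
  if j == 1%N then - Psi 1 * Phi (coor z 1)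
  else Psi (- coor z j.-1) * Phi (- coor z j)
       - Psi (coor z j.-1) * Phi (coor z j).

(* h_(i+1), as i is counted from 0 *)
Definition h (i : 'I_mm) (z : 'cV[R]_dbar) : R :=
  if (i < m1 * m2)%N then
    phi z 1 + 3 * \sum_(1 <= j < (dbar %/ 2).+1) phi z (2 * j)%N
  else if (i < 2 * (m1 * m2))%N then phi z 1
  else phi z 1 + 3 * \sum_(1 <= j < (dbar %/ 2).+1) phi z (2 * j).+1%N.

Definition instf (i : 'I_mm) (z : 'cV[R]_dbar) : R :=
  300 * pi * eps ^+ 2 / (mm%:R * Lf)
    * h i ((Num.sqrt mm%:R * Lf / (150 * pi * eps)) *: z).

Definition block (x : 'cV[R]_(mm * dbar)%N) (i : 'I_mm) : 'cV[R]_dbar :=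
  \col_(k < dbar) x (mxtens_index (i, k)) 0.

Definition instf0 (x : 'cV[R]_(mm * dbar)%N) : R :=
  \sum_(i < mm) instf i (block x i).

Definition instP : SP R (mm * dbar)%N (#|(~: setM)%SET| * dbar)%N (#|setM| * dbar)%N :=
  MkSP instf0 instgbar instA 0 instAbar 0.

(* The two counts give nbar = (3 m2 - 1) dbar and n = (m - 3 m2) dbar. *)
Lemma card_setM : (0 < m1)%N -> #|setM| = (3 * m2).-1%N.
Proof.
move=> m10.
have lt_f (k : 'I_(3 * m2).-1%N) : ((k.+1 * m1).-1 < mm.-1)%N.
  have kP := ltn_ord k.
  have : (k.+1 * m1 < mm)%N by rewrite /mm mulnAC ltn_pmul2r //; lia.
  have : (0 < k.+1 * m1)%N by rewrite muln_gt0.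
  by move: (_ * m1)%N => q; lia.
pose f (k : 'I_(3 * m2).-1%N) := Ordinal (lt_f k).
have fI : injective f.
  move=> k l /(congr1 (fun i => (val i).+1)) /=.
  by rewrite !prednK ?muln_gt0 ?m10 // => /eqP; rewrite eqn_pmul2r // => /eqP [] /val_inj.
suff -> : setM = f @: [set: 'I_(3 * m2).-1%N]%SET by rewrite card_imset // cardsT card_ord.
apply/setP => i; rewrite inE; apply/existsP/imsetP => [[k /andP[k0 /eqP ik]]|[k _ ->]].
  have lk : (k.-1 < (3 * m2).-1)%N by have := ltn_ord k; lia.
  exists (Ordinal lk); rewrite ?inE //.
  by apply/val_inj; rewrite /= prednK // -ik.
have lk : (k.+1 < 3 * m2)%N by have := ltn_ord k; lia.
by exists (Ordinal lk); rewrite /= prednK ?muln_gt0 ?m10.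
Qed.

Lemma card_setMC :
  (0 < m1)%N -> (0 < m2)%N -> #|(~: setM)%SET| = (mm - 3 * m2)%N.
Proof.
move=> m10 m20; have := cardsC setM; rewrite card_setM // card_ord.
have : (3 * m2 <= mm)%N by rewrite /mm mulnAC leq_pmulr.
by move: #|_| => c; lia.
Qed.

End Instance.

(* Main.v *)
(* The blocks x_1, ..., x_m of x sit on a path: A couples neighbouring blocks
   except across the edges of M, and Abar couples those. In the first third of
   the path the gradient of f_0 turns a nonzero coordinate j of a block into a
   nonzero coordinate j + 1 for one parity of j only, in the last third for the
   other parity only, and an oracle call moves information by one edge; so each
   new coordinate costs about m / 3 calls, and (dbar - 1) m / 3 calls are needed
   before the last coordinate of the first block leaves 0.

   It remains to see that this coordinate is nonzero at an eps-stationary point.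
   Summing the stationarity residual over the blocks i <= e isolates the
   multiplier of the edge e; it is too small to be matched by a subgradient of
   gbar at a nonzero y because beta is large, so y = 0 and all blocks nearly
   agree. Summing the residual over all blocks removes the multipliers and
   leaves the averaged gradient, which is large in the first coordinate that is
   not yet of size 1.

   Finally kappa <= 2 m and DeltaF <= 4800 pi^2 eps^2 dbar / Lf, which is enough
   for the constant 72000 pi^2. *)

Require Import Defs.
From mathcomp Require Import all_boot all_order all_algebra.
From mathcomp Require Import mxtens zify ring lra.
From mathcomp Require Import all_classical all_reals all_analysis.

Import Order.TTheory GRing.Theory Num.Theory.
Import numFieldNormedType.Exports.
Local Open Scope ring_scope.

Set Implicit Arguments.
Unset Strict Implicit.
Unset Printing Implicit Defensive.

(** * The scalar functions Psi and Phi *)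

Section Bumps.
Context {R : realType}.
Implicit Types u v a b : R.

Definition dPsi u : R := if u <= 0 then 0 else 2 * u * expR (- u ^+ 2).

Definition dPhi v : R := 4 / (1 + v ^+ 2).

Lemma is_derive_gauss u :
  is_derive u 1 (fun t : R => 1 - expR (- t ^+ 2)) (2 * u * expR (- u ^+ 2)).
Proof.
apply: is_derive_eq.
rewrite /GRing.scale/=. ring.
Qed.

Lemma lipschitz_of_derive_bound (f df : R -> R) (K : R) :
  (forall u, is_derive u 1 f (df u)) -> (forall u, `|df u| <= K) ->
  forall a b, `|f a - f b| <= K * `|a - b|.
Proof.
move=> fd dfK a b; wlog ab : a b / b <= a => [hw|].
  have [/hw//|/ltW/hw] := leP b a.
  by rewrite distrC (distrC b).
have [|c _ ->] := @MVT_segment _ f df _ _ ab (fun x _ => fd x).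
  apply/continuous_subspaceT => x.
  by apply/differentiable_continuous/derivable1_diffP.
by rewrite normrM ler_wpM2r.
Qed.

Lemma dPhi_gt0 v : 0 < dPhi v.
Proof. by rewrite divr_gt0// ltr_pwDl// sqr_ge0. Qed.

Lemma dPhi_le4 v : dPhi v <= 4.
Proof. rewrite ler_pdivrMr ?ltr_pwDl ?sqr_ge0//; nra. Qed.

Lemma dPhiN v : dPhi (- v) = dPhi v.
Proof. by rewrite /dPhi sqrrN. Qed.

(** Once [a - b] is factored out, the remaining quotient has absolute value at most 1, because
    $|a+b| \le (1+a^2)(1+b^2)$. *)
Lemma dPhi_lipschitz a b : `|dPhi a - dPhi b| <= 4 * `|a - b|.
Proof.
have pa : 0 < 1 + a ^+ 2 by rewrite ltr_pwDl// sqr_ge0.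
have pb : 0 < 1 + b ^+ 2 by rewrite ltr_pwDl// sqr_ge0.
have -> : dPhi a - dPhi b = 4 * ((a - b) * (- (a + b) / ((1 + a ^+ 2) * (1 + b ^+ 2)))).
  by rewrite /dPhi; field; rewrite !gt_eqF.
rewrite normrM ger0_norm// ler_pM2l// normrM ler_piMr//.
rewrite normrM normrN normfV (gtr0_norm (mulr_gt0 pa pb)).
rewrite ler_pdivrMr ?mulr_gt0// mul1r ler_norml.
have := sqr_ge0 (a - 1); have := sqr_ge0 (a + 1); have := sqr_ge0 (b - 1).
have := sqr_ge0 (b + 1); have := sqr_ge0 (a * b); have := sqr_ge0 a.
have := sqr_ge0 b.
by move=> *; apply/andP; split; lra.
Qed.

Lemma is_derive_Phi v : is_derive v 1 (@Phi R) (dPhi v).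
Proof.
rewrite /Phi; apply: is_derive_eq.
by rewrite /GRing.scale/= addr0.
Qed.

Lemma Phi_gt0 v : 0 < Phi v.
Proof. by rewrite /Phi; have := atan_gtNpi2 v; lra. Qed.

Lemma Phi_lt v : Phi v < 4 * pi.
Proof. by rewrite /Phi; have := atan_ltpi2 v; lra. Qed.

Lemma Phi_lipschitz a b : `|Phi a - Phi b| <= 4 * `|a - b|.
Proof.
apply: (lipschitz_of_derive_bound is_derive_Phi) => u.
by rewrite (gtr0_norm (dPhi_gt0 u)) dPhi_le4.
Qed.

Lemma exprN2_le1 u : expR (- u ^+ 2) <= 1.
Proof. by rewrite -expR0 ler_expR oppr_le0 sqr_ge0. Qed.

(** This is $|2u| \le 1+u^2 \le e^{u^2}$. *)
Lemma dgauss_bound u : `|2 * u * expR (- u ^+ 2)| <= 1.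
Proof.
rewrite normrM (gtr0_norm (expR_gt0 _)) expRN ler_pdivrMr ?expR_gt0// mul1r.
apply: le_trans (expR_ge1Dx _); rewrite ler_norml.
have := sqr_ge0 (u - 1); have := sqr_ge0 (u + 1).
by move=> *; apply/andP; split; lra.
Qed.

Lemma gauss_lipschitz a b :
  `|(1 - expR (- a ^+ 2)) - (1 - expR (- b ^+ 2))| <= `|a - b|.
Proof.
rewrite -[leRHS]mul1r.
exact: (lipschitz_of_derive_bound is_derive_gauss dgauss_bound).
Qed.

Lemma dgauss_lipschitz a b :
  `|2 * a * expR (- a ^+ 2) - 2 * b * expR (- b ^+ 2)| <= 2 * `|a - b|.
Proof.
apply: (@lipschitz_of_derive_bound (fun u => 2 * u * expR (- u ^+ 2))
          (fun u => (2 - 4 * u ^+ 2) * expR (- u ^+ 2))) => u.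
  apply: is_derive_eq; rewrite /GRing.scale/= ?expr1; ring.
rewrite normrM (gtr0_norm (expR_gt0 _)) expRN ler_pdivrMr ?expR_gt0//.
(* With $s = u^2$ the target is $|2-4s| \le 2e^s$. The bound $1+s \le e^s$ is too weak for $s > 2$;
   used at $s/2$ and squared, it gives a quadratic lower bound, which suffices. *)
have -> : expR (u ^+ 2) = expR (u ^+ 2 / 2) ^+ 2.
  by rewrite [RHS]expr2 -expRD -splitr.
have := expR_ge1Dx (u ^+ 2 / 2); have := sqr_ge0 u.
move: (u ^+ 2) (expR _) => s e s0 es.
have : (1 + s / 2) ^+ 2 <= e ^+ 2 by rewrite ler_pXn2r ?nnegrE//; lra.
have := sqr_ge0 (s - 2); have := sqr_ge0 s; rewrite ler_norml.
by move=> *; apply/andP; split; lra.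
Qed.

(** This form composes a smooth function with the 1-Lipschitz truncation at 0, so the Lipschitz
    bounds above carry over without splitting on signs. *)
Lemma PsiE u : Psi u = 1 - expR (- Num.max u 0 ^+ 2).
Proof.
rewrite /Psi; case: (leP u 0) => u0 //.
by rewrite expr0n/= oppr0 expR0 subrr.
Qed.

Lemma dPsiE u : dPsi u = 2 * Num.max u 0 * expR (- Num.max u 0 ^+ 2).
Proof. by rewrite /dPsi; case: (leP u 0) => u0 //; rewrite mulr0 mul0r. Qed.

Lemma maxr0_lipschitz a b : `|Num.max a 0 - Num.max b 0| <= `|a - b|.
Proof.
rewrite ler_norml; have := ler_norm (a - b); have := ler_norm (b - a).
rewrite (distrC b); move: `|_| => N.
by case: (leP a 0) => ?; case: (leP b 0) => ?; lra.
Qed.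

Lemma Psi_lipschitz a b : `|Psi a - Psi b| <= `|a - b|.
Proof. by rewrite !PsiE; exact: le_trans (gauss_lipschitz _ _) (maxr0_lipschitz _ _). Qed.

Lemma dPsi_lipschitz a b : `|dPsi a - dPsi b| <= 2 * `|a - b|.
Proof.
rewrite !dPsiE; apply: le_trans (dgauss_lipschitz _ _) _.
by rewrite ler_pM2l ?maxr0_lipschitz.
Qed.

Lemma Psi_ge0 u : 0 <= Psi u.
Proof. by rewrite PsiE subr_ge0 exprN2_le1. Qed.

Lemma Psi_le1 u : Psi u <= 1.
Proof. by rewrite PsiE gerBl expR_ge0. Qed.

Lemma dPsi_ge0 u : 0 <= dPsi u.
Proof. by rewrite dPsiE mulr_ge0 ?expR_ge0// mulr_ge0// le_max lexx orbT. Qed.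

Lemma dPsi_le1 u : dPsi u <= 1.
Proof. by rewrite dPsiE; exact: le_trans (ler_norm _) (dgauss_bound _). Qed.

Lemma Psi_le0 u : u <= 0 -> Psi u = 0.
Proof. by rewrite /Psi => ->. Qed.

Lemma dPsi_le0 u : u <= 0 -> dPsi u = 0.
Proof. by rewrite /dPsi => ->. Qed.

Lemma dPsi_sym_le1 a : dPsi a + dPsi (- a) <= 1.
Proof.
have [a0|/ltW a0] := leP a 0; first by rewrite dPsi_le0// add0r dPsi_le1.
by rewrite (@dPsi_le0 (- a)) ?oppr_le0// addr0 dPsi_le1.
Qed.

(** Follows from $e^{u^2} \ge 1+c^2$. It is used at $c = 1$, giving 1/2, and at $c = 4/5$, giving
    16/41. *)
Lemma Psi_ge (u c : R) : 0 <= c -> c <= u -> c ^+ 2 / (1 + c ^+ 2) <= Psi u.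
Proof.
move=> c0 cu; have u0 := le_trans c0 cu.
rewrite PsiE max_l//.
have le_e : 1 + c ^+ 2 <= expR (u ^+ 2).
  by apply: le_trans (expR_ge1Dx _); rewrite lerD2l ler_sqr ?nnegrE.
have p : 0 < 1 + c ^+ 2 by rewrite ltr_pwDl// sqr_ge0.
have -> : c ^+ 2 / (1 + c ^+ 2) = 1 - (1 + c ^+ 2)^-1 by field; rewrite gt_eqF.
by rewrite lerD2l lerN2 expRN lef_pV2// posrE ?expR_gt0.
Qed.

Lemma is_derive_Psi u : is_derive u 1 (@Psi R) (dPsi u).
Proof.
have [u0|u0|->] := ltgtP u 0.
- rewrite dPsi_le0 ?ltW//; apply: (@near_eq_is_derive _ _ _ (cst 0)).
  near=> t; rewrite Psi_le0// ltW//.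
  by near: t; exact: lt_nbhsl.
- rewrite /dPsi leNgt u0/=.
  apply: near_eq_is_derive (is_derive_gauss u).
  near=> t; rewrite /Psi leNgt ifF//; apply/negbTE; rewrite negbK.
  by near: t; exact: lt_nbhsr.
rewrite dPsi_le0//.
(* At the junction 0 the inequality $\Psi(h) \le h^2$ bounds the difference quotient by $|h|$, so
   the derivative there is 0. *)
have Pq (h : R) : `|h^-1 *: (Psi h - Psi 0)| <= `|h|.
  rewrite (@Psi_le0 0)// subr0 /GRing.scale/= normrM normfV.
  have [->|h0] := eqVneq h 0; first by rewrite normr0 invr0 mul0r.
  rewrite ler_pdivrMl ?normr_gt0// -expr2 real_normK ?num_real//.
  rewrite ger0_norm ?Psi_ge0// PsiE.
  rewrite lerBlDl -lerBlDr; apply: le_trans (expR_ge1Dx _).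
  rewrite lerD2l lerN2; have [h0'|/ltW h0'] := leP h 0; rewrite ?expr0n ?sqr_ge0//.
have : ((fun h : R => h^-1 *: ((Psi \o shift 0) (h *: 1) - Psi 0)) @ 0^' --> (0 : R))%classic.
  apply/cvgr0Pnorm_le => e e0; near=> h.
  rewrite /= addr0 /GRing.scale/= mulr1.
  apply: le_trans (Pq h) _; near: h.
  apply: (@dnbhs0_le _ R^o); exact: e0.
move=> c; split; first by apply/cvg_ex; exists 0.
exact: cvg_lim c.
Unshelve. all: by end_near. Qed.

End Bumps.

(** * Differentials *)

Section HasDifferential.
Context {R : realType} {V : normedModType R}.
Implicit Types (f g df dg : V -> R) (x : V).

(** Pairing differentiability with an explicit formula for all directional derivatives gives
    calculus rules that compose, from which the gradient of [instf0] is read off. *)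
Definition has_differential f x df : Prop :=
  differentiable f x /\ forall v, 'D_v f x = df v.

Lemma has_differential_cst (a : R) x : has_differential (fun=> a) x (fun=> 0).
Proof. by split=> [|v]; [exact: differentiable_cst|exact: derive_cst]. Qed.

Lemma has_differentialB f g x df dg : has_differential f x df ->
  has_differential g x dg ->
  has_differential (fun y => f y - g y) x (fun v => df v - dg v).
Proof.
move=> [fx fE] [gx gE]; split=> [|v]; first exact: differentiableB.
by rewrite -fE -gE deriveB//; exact: diff_derivable.
Qed.

Lemma has_differentialD f g x df dg : has_differential f x df ->
  has_differential g x dg ->
  has_differential (fun y => f y + g y) x (fun v => df v + dg v).
Proof.
move=> [fx fE] [gx gE]; split=> [|v]; first exact: differentiableD.
by rewrite -fE -gE deriveD//; exact: diff_derivable.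
Qed.

Lemma has_differentialM f g x df dg : has_differential f x df ->
  has_differential g x dg ->
  has_differential (fun y => f y * g y) x (fun v => f x * dg v + g x * df v).
Proof.
move=> [fx fE] [gx gE]; split=> [|v]; first exact: differentiableM.
by rewrite -fE -gE deriveM//; exact: diff_derivable.
Qed.

Lemma has_differentialZ (k : R) f x df : has_differential f x df ->
  has_differential (fun y => k * f y) x (fun v => k * df v).
Proof.
move=> [fx fE]; split=> [|v]; first exact: differentiableZ.
by rewrite -fE deriveZ//; exact: diff_derivable.
Qed.

Lemma has_differential_sum n (F dF : 'I_n -> V -> R) x :
  (forall i, has_differential (F i) x (dF i)) ->
  has_differential (fun y => \sum_(i < n) F i y) x (fun v => \sum_(i < n) dF i v).
Proof.
move=> FE; have -> : (fun y => \sum_(i < n) F i y) = \sum_(i < n) F i.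
  by apply/funext => y; rewrite fct_sumE.
split=> [|v]; first by apply: differentiable_sum => i; case: (FE i).
rewrite derive_sum; first by apply: eq_bigr => i _; case: (FE i).
by move=> i; apply: diff_derivable; case: (FE i).
Qed.

Lemma has_differential_comp (F : R -> R) (a : R) f x df :
  is_derive (f x) 1 F a -> has_differential f x df ->
  has_differential (fun y => F (f y)) x (fun v => a * df v).
Proof.
move=> Fa [fx fE]; have dF : differentiable F (f x).
  exact/derivable1_diffP/ex_derive.
split=> [|v]; first exact: differentiable_comp.
rewrite (_ : (fun y => _) = F \o f)// deriveE; last exact: differentiable_comp.
rewrite diff_comp//= -(deriveE v fx) fE diff1E// derive1E derive_val /GRing.scale/=.
exact: mulrC.
Qed.

End HasDifferential.

(** * The coupling of two consecutive coordinates and its partial derivatives *)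

Section Link.
Context {R : realType}.
Implicit Types a b : R.

(** This is [phi] at an index past the first, as a function of the previous and the current
    coordinate; [link1] and [link2] are its partial derivatives. *)
Definition link a b : R := Psi (- a) * Phi (- b) - Psi a * Phi b.

Definition link1 a b : R := - (dPsi (- a) * Phi (- b)) - dPsi a * Phi b.

(** At most one of [Psi a] and [Psi (- a)] is nonzero and [dPhi] is even, so the two terms of the
    derivative merge into one. *)
Definition link2 a b : R := - (Psi `|a| * dPhi b).

Lemma Psi_symE a : Psi a + Psi (- a) = Psi `|a|.
Proof.
have [a0|/ltW a0] := leP a 0.
  by rewrite (Psi_le0 a0) add0r ler0_norm.
by rewrite (@Psi_le0 _ (- a)) ?oppr_le0// addr0 ger0_norm.
Qed.

Lemma link_ge a b : - (4 * pi) <= link a b.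
Proof.
have p0 : 0 <= Psi (- a) * Phi (- b) by rewrite mulr_ge0 ?Psi_ge0 ?ltW ?Phi_gt0.
suff : Psi a * Phi b <= 4 * pi by rewrite /link; lra.
rewrite -[leRHS]mul1r ler_pM ?Psi_ge0 ?Psi_le1 ?ltW ?Phi_gt0 ?Phi_lt//.
Qed.

Lemma link0l b : link 0 b = 0.
Proof. by rewrite /link oppr0 Psi_le0// !mul0r subr0. Qed.

Lemma link10l b : link1 0 b = 0.
Proof. by rewrite /link1 oppr0 dPsi_le0// !mul0r subr0 oppr0. Qed.

Lemma link20l b : link2 0 b = 0.
Proof. by rewrite /link2 normr0 Psi_le0// mul0r oppr0. Qed.

Lemma link1_le0 a b : link1 a b <= 0.
Proof.
have p c d : 0 <= dPsi c * Phi d :> R by rewrite mulr_ge0 ?dPsi_ge0 ?ltW ?Phi_gt0.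
by rewrite /link1; have := p (- a) (- b); have := p a b; lra.
Qed.

(** The weights [dPsi a] and [dPsi (- a)] are nonnegative with sum at most 1, and both values of
    [Phi] lie below $4\pi$. *)
Lemma link1_bound a b : `|link1 a b| <= 4 * pi.
Proof.
rewrite ler0_norm ?link1_le0// /link1 opprB opprK.
have := Phi_lt b; have := Phi_lt (- b); have := dPsi_sym_le1 a.
have := dPsi_ge0 a; have := dPsi_ge0 (- a); have := @pi_gt0 R.
move: (dPsi _) (dPsi _) (Phi _) (Phi _) (pi) => r s t u p *; nra.
Qed.

Lemma link2_le0 a b : link2 a b <= 0.
Proof. by rewrite /link2 oppr_le0 mulr_ge0 ?Psi_ge0 ?ltW ?dPhi_gt0. Qed.

Lemma link2_bound a b : `|link2 a b| <= 4.
Proof.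
rewrite ler0_norm ?link2_le0// /link2 opprK -[leRHS]mul1r.
by rewrite ler_pM ?Psi_ge0 ?Psi_le1 ?dPhi_le4 ?ltW ?dPhi_gt0.
Qed.

Lemma distM_le (p q p' q' : R) :
  `|p * q - p' * q'| <= `|q| * `|p - p'| + `|p'| * `|q - q'|.
Proof.
have -> : p * q - p' * q' = q * (p - p') + p' * (q - q') by ring.
by rewrite -!normrM ler_normD.
Qed.

Lemma Phi_norm b : `|Phi b| <= 4 * pi.
Proof. by rewrite gtr0_norm ?Phi_gt0// ltW ?Phi_lt. Qed.

Lemma link1_lipschitz a b a' b' :
  `|link1 a b - link1 a' b'| <= 16 * pi * `|a - a'| + 4 * `|b - b'|.
Proof.
have -> : link1 a b - link1 a' b' =
    (dPsi (- a') * Phi (- b') - dPsi (- a) * Phi (- b)) +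
    (dPsi a' * Phi b' - dPsi a * Phi b) by rewrite /link1; ring.
(* The factor [dPsi c] is kept in the second term: the two uses of [H] then have weights summing to
   at most 1, so the constant for [b] is 4 rather than 8. *)
have H (c d c' d' : R) : `|dPsi c' * Phi d' - dPsi c * Phi d|
   <= 8 * pi * `|c - c'| + dPsi c * (4 * `|d - d'|).
  apply: le_trans (distM_le _ _ _ _) _; rewrite (distrC c) (distrC d).
  rewrite (ger0_norm (dPsi_ge0 c)); apply: lerD.
    have -> : 8 * pi * `|c' - c| = (4 * pi) * (2 * `|c' - c|) by ring.
    by rewrite ler_pM ?Phi_norm ?dPsi_lipschitz.
  by rewrite ler_wpM2l ?dPsi_ge0 ?Phi_lipschitz.
apply: le_trans (ler_normD _ _) _; apply: le_trans (lerD (H _ _ _ _) (H _ _ _ _)) _.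
have N (u v : R) : `|- u - (- v)| = `|u - v| by rewrite -opprD normrN.
rewrite !N; have := dPsi_sym_le1 a; have := normr_ge0 (b - b').
by move: `|_| `|_| (dPsi _) (dPsi _) => r s t u *; nra.
Qed.

Lemma link2_lipschitz a b a' b' :
  `|link2 a b - link2 a' b'| <= 4 * `|a - a'| + 4 * `|b - b'|.
Proof.
rewrite /link2 -opprD normrN; apply: le_trans (distM_le _ _ _ _) _.
rewrite (gtr0_norm (dPhi_gt0 b)) (ger0_norm (Psi_ge0 _)); apply: lerD.
  rewrite ler_pM ?dPhi_le4 ?(ltW (dPhi_gt0 _))//.
  exact: le_trans (Psi_lipschitz _ _) (ler_dist_dist _ _).
rewrite -[leRHS]mul1r ler_pM ?Psi_ge0 ?Psi_le1// dPhi_lipschitz//.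
Qed.

Lemma has_differential_link (V : normedModType R) (f g df dg : V -> R) (x : V) :
  has_differential f x df -> has_differential g x dg ->
  has_differential (fun y => link (f y) (g y)) x
    (fun v => link1 (f x) (g x) * df v + link2 (f x) (g x) * dg v).
Proof.
move=> fd gd.
have N k dk : has_differential k x dk ->
    has_differential (fun y => - k y) x (fun v => - dk v).
  move=> kd; have := has_differentialZ (-1) kd.
  under eq_fun do rewrite mulN1r.
  by under [X in has_differential _ _ X]eq_fun do rewrite mulN1r.
have P k dk : has_differential k x dk ->
    has_differential (fun y => Psi (k y)) x (fun v => dPsi (k x) * dk v).
  by move=> kd; apply: has_differential_comp kd; exact: is_derive_Psi.
have Q k dk : has_differential k x dk ->
    has_differential (fun y => Phi (k y)) x (fun v => dPhi (k x) * dk v).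
  by move=> kd; apply: has_differential_comp kd; exact: is_derive_Phi.
have := has_differentialB (has_differentialM (P _ _ (N _ _ fd)) (Q _ _ (N _ _ gd)))
  (has_differentialM (P _ _ fd) (Q _ _ gd)).
congr has_differential; apply/funext => v.
by rewrite /link1 /link2 dPhiN -Psi_symE; ring.
Qed.

End Link.

(** * The chain functions h_i *)

Section Chain.
Context {R : realType}.
Variables m1 m2 dbar : nat.
Local Notation p := (m1 * m2)%N.
Implicit Types (z : nat -> R) (i k : nat).

(** Here [k] counts from 0, so the terms [phi z (2 * j)] of [h] are the links leaving even [k], and
    the terms at [2 * j + 1] those leaving odd [k]. The guard removes the link that would leave the
    last coordinate. *)
Definition coef i k : R :=
  if (k.+1 < dbar)%N && ((i < p)%N && ~~ odd k || (2 * p <= i)%N && odd k)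
  then 3 else 0.

(* [chain] is h_(i+1) on the coordinates z 0, ..., z (dbar - 1), and [dchain]
   is its gradient. *)
Definition chain i z : R :=
  - Psi 1 * Phi (z 0%N) + \sum_(k < dbar) coef i k * link (z k) (z k.+1).

Definition dchain i z k : R :=
  (if k == 0%N then - (Psi 1 * dPhi (z 0%N)) else 0)
  + coef i k * link1 (z k) (z k.+1)
  + (if k is l.+1 then coef i l * link2 (z l) (z k) else 0).

Lemma coef_bound i k : 0 <= coef i k <= 3.
Proof. by rewrite /coef; case: ifP => _; rewrite ?lexx ?ler0n. Qed.

Lemma coef_ge0 i k : 0 <= coef i k.
Proof. by case/andP: (coef_bound i k). Qed.

(** Each link costs at most $3 \cdot 4\pi$ and the head at most $4\pi$, and $12\pi\bar d + 4\pi \le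
    16\pi\bar d$. *)
Lemma chain_ge i z : (0 < dbar)%N -> - (16 * pi * dbar%:R) <= chain i z.
Proof.
move=> d0; rewrite /chain.
have H : \sum_(k < dbar) - (12 * pi) <= \sum_(k < dbar) coef i k * link (z k) (z k.+1).
  apply: ler_sum => k _; have := link_ge (z k) (z k.+1).
  have /andP[] := coef_bound i k; have := @pi_gt0 R.
  by move: (coef _ _) (link _ _) pi => a b c *; nra.
rewrite sumr_const card_ord -[_ *+ dbar]mulr_natr in H.
have Q : Psi 1 * Phi (z 0%N) <= 4 * pi.
  by rewrite -[leRHS]mul1r ler_pM ?Psi_ge0 ?Psi_le1 ?(ltW (Phi_gt0 _)) ?(ltW (Phi_lt _)).
have D : 1 <= dbar%:R :> R by rewrite ler1n.
rewrite mulNr; have : 0 <= pi * (dbar%:R - 1) :> R by rewrite mulr_ge0 ?pi_ge0 ?subr_ge0.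
by move: H Q; move: (Psi 1 * _) (\sum_(k < _) _) pi (dbar%:R) => a b c e *; lra.
Qed.

Lemma chain0_le0 i : chain i (fun=> 0) <= 0.
Proof.
rewrite /chain big1 ?addr0; last by move=> k _; rewrite link0l mulr0.
by rewrite mulNr oppr_le0 mulr_ge0 ?Psi_ge0// ltW ?Phi_gt0.
Qed.

(** The [link1] term is at most $12\pi$ and the remaining ones at most 12 in absolute value, so $\pi
    \ge 2$ is enough. *)
Lemma dchain_bound i z k : `|dchain i z k| <= 25 * pi.
Proof.
have pi2 := @pi_ge2 R.
have c1 : `|coef i k * link1 (z k) (z k.+1)| <= 12 * pi.
  have -> : 12 * pi = 3 * (4 * pi) :> R by ring.
  rewrite normrM ger0_norm ?coef_ge0// ler_pM ?coef_ge0 ?link1_bound//.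
  by case/andP: (coef_bound i k).
rewrite /dchain; apply: le_trans (ler_normD _ _) _.
case: k c1 => [|k] c1 /=.
  rewrite normr0 addr0; apply: le_trans (ler_normD _ _) _.
  suff : `|- (Psi 1 * dPhi (z 0%N))| <= 4 by lra.
  rewrite normrN normrM (ger0_norm (Psi_ge0 _)) (gtr0_norm (dPhi_gt0 _)).
  by rewrite -[leRHS]mul1r ler_pM ?Psi_ge0 ?Psi_le1 ?dPhi_le4 ?(ltW (dPhi_gt0 _)).
rewrite add0r.
suff : `|coef i k * link2 (z k) (z k.+1)| <= 3 * 4 by lra.
rewrite normrM ger0_norm ?coef_ge0// ler_pM ?coef_ge0 ?link2_bound//.
by case/andP: (coef_bound i k).
Qed.

(** The zero-chain property: [link1] and [link2] both vanish when their first argument is 0, so a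
    zero coordinate can only be awakened by an active link from a nonzero predecessor. *)
Lemma dchain_eq0 i z k : (0 < k)%N -> z k = 0 ->
  coef i k.-1 = 0 \/ z k.-1 = 0 -> dchain i z k = 0.
Proof.
case: k => // k _ zk H; rewrite /dchain/= zk link10l mulr0 !add0r.
by case: H => /= ->; rewrite ?mul0r ?link20l ?mulr0.
Qed.

Lemma dchain_le0 i z k : dchain i z k <= 0.
Proof.
rewrite /dchain; have H1 : coef i k * link1 (z k) (z k.+1) <= 0.
  by rewrite mulr_ge0_le0 ?coef_ge0 ?link1_le0.
case: k H1 => [|k] /= H1.
  have : 0 <= Psi 1 * dPhi (z 0%N) by rewrite mulr_ge0 ?Psi_ge0 ?(ltW (dPhi_gt0 _)).
  by move: (Psi _ * _) H1 => ? ?; lra.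
have : coef i k * link2 (z k) (z k.+1) <= 0.
  by rewrite mulr_ge0_le0 ?coef_ge0 ?link2_le0.
by move: (_ * _) H1 => ? ?; lra.
Qed.

Lemma dPhi_ge (v : R) : `|v| <= 6 / 5 -> 8 / 5 <= dPhi v.
Proof.
move=> v6; have : v ^+ 2 <= (6 / 5) ^+ 2.
  by rewrite -(real_normK (num_real v)) ler_pXn2r ?nnegrE// divr_ge0.
rewrite /dPhi ler_pdivlMr ?ltr_pwDl ?sqr_ge0//.
by move: (v ^+ 2) => s; lra.
Qed.

Lemma dchain_head_le i z : `|z 0%N| <= 6 / 5 -> dchain i z 0 <= - (3 / 5).
Proof.
move=> z0; rewrite /dchain/= addr0.
have H1 : coef i 0 * link1 (z 0%N) (z 1%N) <= 0.
  by rewrite mulr_ge0_le0 ?coef_ge0 ?link1_le0.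
have P1 : 1 / 2 <= Psi 1 :> R.
  apply: le_trans (Psi_ge (c := 1) _ _) => //; rewrite expr1n; exact: lexx.
have : 1 / 2 * (8 / 5) <= Psi 1 * dPhi (z 0%N).
  by rewrite ler_pM ?dPhi_ge ?divr_ge0.
by move: H1; move: (_ * link1 _ _) (Psi 1 * _) => a b *; lra.
Qed.

(** The constant comes from $3 \cdot (16/41) \cdot (8/5) > 9/5$. The weight 3 makes up for the link
    being active in one third of the blocks only: averaged over all blocks, 9/5 becomes the 3/5 of
    the head coordinate. *)
Lemma dchain_link_le i z k : coef i k = 3 -> 4 / 5 <= `|z k| ->
  `|z k.+1| <= 6 / 5 -> dchain i z k.+1 <= - (9 / 5).
Proof.
move=> c3 zk zk1; rewrite /dchain/= add0r c3.
have H1 : coef i k.+1 * link1 (z k.+1) (z k.+2) <= 0.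
  by rewrite mulr_ge0_le0 ?coef_ge0 ?link1_le0.
have Pk : 16 / 41 <= Psi `|z k|.
  apply: le_trans (Psi_ge (c := 4 / 5) _ zk); last by rewrite divr_ge0.
  by rewrite ler_pdivlMr; lra.
have : 16 / 41 * (8 / 5) <= Psi `|z k| * dPhi (z k.+1).
  by rewrite ler_pM ?dPhi_ge ?divr_ge0.
rewrite /link2; move: H1; move: (_ * link1 _ _) (Psi _ * _) => a b *; lra.
Qed.

Lemma sum_pairs n (F : nat -> R) :
  \sum_(k < n.*2) F k = \sum_(j < n) (F j.*2 + F j.*2.+1).
Proof.
by elim: n => [|n IHn]; rewrite ?big_ord0// doubleS !big_ord_recr/= IHn addrA.
Qed.

Lemma h_chain (eps Lf : R) (i : 'I_(mm m1 m2)) (z : 'cV[R]_dbar) : odd dbar ->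
  h i z = chain i (fun k => coor z k.+1).
Proof.
move=> odd_d; have dE : dbar = (dbar./2).*2.+1 by rewrite -[LHS]odd_double_half odd_d.
rewrite /h /chain; set c := coor z.
have ph1 : phi z 1 = - Psi 1 * Phi (c 1%N) by rewrite /phi eqxx.
have phS k : phi z k.+2 = link (c k.+1) (c k.+2) by [].
have d2 : (dbar %/ 2)%N = dbar./2 by rewrite divn2.
have -> : \sum_(k < dbar) coef i k * link (c k.+1) (c k.+2) =
    \sum_(j < dbar./2) (coef i j.*2 * phi z j.*2.+2
                        + coef i j.*2.+1 * phi z j.*2.+3).
  transitivity (\sum_(k < (dbar./2).*2.+1) coef i k * link (c k.+1) (c k.+2)).
    by rewrite -dE.
  (* The index [dbar.-1] has coefficient 0 by the guard in [coef]; the even number of indices that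
     remain is split into pairs. *)
  rewrite big_ord_recr/= [coef i _.*2]/coef -dE ltnn mul0r addr0.
  by rewrite (sum_pairs _ (fun k => coef i k * link (c k.+1) (c k.+2))).
have lt_d (j : 'I_dbar./2) : (j.*2.+2 < dbar)%N /\ (j.*2.+1 < dbar)%N.
  by have := ltn_ord j; lia.
rewrite ph1 big_add1 big_mkord d2.
case: ifP => [ip|/negbT ip]; [|case: ifP => [i2p|/negbT i2p]].
- congr (_ + _); rewrite mulr_sumr; apply: eq_bigr => j _.
  have [_ l1] := lt_d j.
  rewrite /coef l1 ip odd_double/= (ifN _ _ (_ : ~~ (_ && _))); last first.
    by rewrite leqNgt negb_and negb_or negb_and /= odd_double /=; lia.
  by rewrite mul0r addr0 mul2n.
- rewrite big1 ?addr0// => j _; rewrite /coef !ifN ?mul0r ?addr0//;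
  by rewrite negb_and negb_or !negb_and; lia.
- congr (_ + _); rewrite big_add1 big_mkord mulr_sumr; apply: eq_bigr => j _.
  have [l1 _] := lt_d j.
  rewrite -leqNgt in i2p.
  rewrite /coef (ifN _ _ (_ : ~~ (_ && _))) ?mul0r ?add0r; last first.
    by rewrite odd_double; lia.
  rewrite ifT; last by rewrite l1 i2p /= odd_double /= orbT.
  by rewrite mul2n.
Qed.

(** A tridiagonal operator with constant diagonals [a], [b], [b] has norm at most [a + 2 * b].
    Convexity of the square with these weights bounds each term, and shifting a sequence that
    vanishes at [n] does not increase its sum of squares. *)
Lemma sum_tridiag_sqr_le n (u : nat -> R) (a b : R) : 0 <= a -> 0 <= b ->
  u n = 0 ->
  \sum_(k < n) (a * u k + b * u k.+1 + b * (if val k is l.+1 then u l else 0) : R) ^+ 2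
  <= (a + 2 * b) ^+ 2 * \sum_(k < n) u k ^+ 2.
Proof.
move=> a0 b0 un.
pose w k : R := if k is l.+1 then u l else 0.
have pt k : (a * u k + b * u k.+1 + b * w k) ^+ 2
    <= (a + 2 * b) * (a * u k ^+ 2 + b * u k.+1 ^+ 2 + b * w k ^+ 2).
  rewrite -subr_ge0.
  have -> : (a + 2 * b) * (a * u k ^+ 2 + b * u k.+1 ^+ 2 + b * w k ^+ 2)
    - (a * u k + b * u k.+1 + b * w k) ^+ 2
    = a * b * (u k - u k.+1) ^+ 2 + a * b * (u k - w k) ^+ 2
      + b * b * (u k.+1 - w k) ^+ 2 by ring.
  by rewrite !addr_ge0// mulr_ge0 ?sqr_ge0// mulr_ge0.
apply: (@le_trans _ _ (\sum_(k < n)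
    (a + 2 * b) * (a * u k ^+ 2 + b * u k.+1 ^+ 2 + b * w k ^+ 2))).
  by apply: ler_sum => k _; exact: pt.
rewrite -mulr_sumr expr2 -mulrA ler_wpM2l ?addr_ge0 ?mulr_ge0//.
rewrite !big_split/= -!mulr_sumr.
suff [s1 s2] : \sum_(k < n) u k.+1 ^+ 2 <= \sum_(k < n) u k ^+ 2 /\
    \sum_(k < n) w k ^+ 2 <= \sum_(k < n) u k ^+ 2.
  by move: s1 s2; move: (\sum_(k < n) _) (\sum_(k < n) _) (\sum_(k < n) _) => *; nra.
case: n un => [|n] un; first by rewrite !big_ord0.
split.
  rewrite big_ord_recr/= un expr0n addr0 [leRHS]big_ord_recl/=.
  by rewrite lerDr sqr_ge0.
rewrite big_ord_recl/= expr0n add0r [leRHS]big_ord_recr/=.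
by rewrite lerDl sqr_ge0.
Qed.

(** Entry [k] of [dchain] depends on coordinates [k.-1], [k] and [k.+1] only, which gives
    tridiagonal bounds with diagonal $48\pi+16$ and off-diagonals 12; their total $48\pi+40$ is
    below $75\pi$. *)
Lemma dchain_lipschitz i z z' : z dbar = z' dbar ->
  \sum_(k < dbar) (dchain i z k - dchain i z' k) ^+ 2
  <= (75 * pi) ^+ 2 * \sum_(k < dbar) (z k - z' k) ^+ 2.
Proof.
move=> zz'; pose u k := `|z k - z' k|; have pi2 := @pi_ge2 R.
have u0 k : 0 <= u k by exact: normr_ge0.
have pt k : `|dchain i z k - dchain i z' k| <=
   (48 * pi + 16) * u k + 12 * u k.+1 + 12 * (if k is l.+1 then u l else 0).
  have -> : dchain i z k - dchain i z' k =
     (if k == 0%N then - (Psi 1 * (dPhi (z 0%N) - dPhi (z' 0%N))) else 0) +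
     coef i k * (link1 (z k) (z k.+1) - link1 (z' k) (z' k.+1)) +
     (if k is l.+1 then coef i l * (link2 (z l) (z k) - link2 (z' l) (z' k)) else 0).
    by rewrite /dchain; case: k => [|k]/=; ring.
  have c1 : `|coef i k * (link1 (z k) (z k.+1) - link1 (z' k) (z' k.+1))| <=
      3 * (16 * pi * u k + 4 * u k.+1).
    rewrite normrM ger0_norm ?coef_ge0// ler_pM ?coef_ge0 ?link1_lipschitz//.
    by case/andP: (coef_bound i k).
  apply: le_trans (ler_normD _ _) _.
  case: k c1 => [|k] c1 /=.
    rewrite normr0 addr0; apply: le_trans (ler_normD _ _) _.
    suff : `|- (Psi 1 * (dPhi (z 0%N) - dPhi (z' 0%N)))| <= 1 * (4 * u 0%N).
      have := u0 0%N; have := u0 1%N; lra.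
    rewrite normrN normrM ger0_norm ?Psi_ge0// ler_pM ?Psi_ge0 ?Psi_le1//.
    exact: dPhi_lipschitz.
  rewrite add0r.
  suff : `|coef i k * (link2 (z k) (z k.+1) - link2 (z' k) (z' k.+1))| <=
      3 * (4 * u k + 4 * u k.+1).
    have := u0 k; have := u0 k.+1; have := u0 k.+2; lra.
  rewrite normrM ger0_norm ?coef_ge0// ler_pM ?coef_ge0 ?link2_lipschitz//.
  by case/andP: (coef_bound i k).
apply: (@le_trans _ _ (\sum_(k < dbar) ((48 * pi + 16) * u k + 12 * u k.+1
    + 12 * (if val k is l.+1 then u l else 0)) ^+ 2)).
  apply: ler_sum => k _; rewrite -(real_normK (num_real (_ - _))).
  by rewrite ler_pXn2r ?nnegrE// (le_trans _ (pt k)).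
have un : u dbar = 0 by rewrite /u zz' subrr normr0.
apply: le_trans (sum_tridiag_sqr_le _ _ un) _ => //; first lra.
under eq_bigr do rewrite /u real_normK ?num_real//.
rewrite ler_wpM2r ?sumr_ge0// => [*|]; first exact: sqr_ge0.
by rewrite ler_pXn2r ?nnegrE//; lra.
Qed.

End Chain.

(** * The path and the condition number *)

Section Euclid.
Context {R : realType}.

Lemma norm2_ge0 n (v : 'cV[R]_n) : 0 <= norm2 v.
Proof. exact: sqrtr_ge0. Qed.

Lemma norm2_sqr n (v : 'cV[R]_n) : norm2 v ^+ 2 = \sum_(i < n) v i 0 ^+ 2.
Proof. by rewrite sqr_sqrtr// sumr_ge0// => i _; exact: sqr_ge0. Qed.

Lemma norm2_le n (v : 'cV[R]_n) (c : R) : 0 <= c ->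
  (norm2 v <= c) = (\sum_(i < n) v i 0 ^+ 2 <= c ^+ 2).
Proof. by move=> c0; rewrite -norm2_sqr ler_pXn2r ?nnegrE ?norm2_ge0. Qed.

Lemma coord_le_norm2 n (v : 'cV[R]_n) i : `|v i 0| <= norm2 v.
Proof.
rewrite -(ler_pXn2r (_ : 0 < 2)%N) ?nnegrE ?norm2_ge0// norm2_sqr.
rewrite real_normK ?num_real// (bigD1 i)//= lerDl.
by apply: sumr_ge0 => j _; exact: sqr_ge0.
Qed.

Lemma norm2_trmul n (v : 'cV[R]_n) : (v^T *m v) 0 0 = norm2 v ^+ 2.
Proof. by rewrite norm2_sqr mxE; apply: eq_bigr => i _; rewrite mxE expr2. Qed.

Lemma norm2_eq0 n (v : 'cV[R]_n) : norm2 v = 0 -> v = 0.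
Proof.
move=> v0; apply/matrixP => i j; rewrite ord1 mxE.
by have := coord_le_norm2 v i; rewrite v0 normr_le0 => /eqP.
Qed.

(** Cauchy-Schwarz against the constant vector, by Lagrange's identity: twice the gap is the sum of
    all $(f_i-f_j)^2$. *)
Lemma sqr_sum_le n (f : 'I_n -> R) :
  (\sum_(i < n) f i) ^+ 2 <= n%:R * \sum_(i < n) f i ^+ 2.
Proof.
suff : 0 <= 2 * (n%:R * \sum_(i < n) f i ^+ 2 - (\sum_(i < n) f i) ^+ 2).
  by rewrite pmulr_rge0// subr_ge0.
suff -> : 2 * (n%:R * \sum_(i < n) f i ^+ 2 - (\sum_(i < n) f i) ^+ 2) =
    \sum_(i < n) \sum_(j < n) (f i - f j) ^+ 2.
  by apply: sumr_ge0 => i _; apply: sumr_ge0 => j _; exact: sqr_ge0.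
have -> : \sum_(i < n) \sum_(j < n) (f i - f j) ^+ 2 =
    \sum_(i < n) (n%:R * f i ^+ 2 - 2 * (f i * \sum_(j < n) f j)
                  + \sum_(j < n) f j ^+ 2).
  apply: eq_bigr => i _.
  rewrite (eq_bigr (fun j => f i ^+ 2 - 2 * (f i * f j) + f j ^+ 2)); last first.
    by move=> j _; ring.
  by rewrite big_split/= sumrB sumr_const card_ord -!mulr_sumr [n%:R * _]mulr_natl.
rewrite big_split/= sumrB -!mulr_sumr -mulr_suml sumr_const card_ord -[_ *+ n]mulr_natl.
ring.
Qed.

Lemma sqr_sum_cond_le n (P : pred 'I_n) (f : 'I_n -> R) :
  (\sum_(i < n | P i) f i) ^+ 2 <= n%:R * \sum_(i < n) f i ^+ 2.
Proof.
rewrite big_mkcond; apply: le_trans (sqr_sum_le _) _.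
rewrite ler_wpM2l//; apply: ler_sum => i _.
by case: ifP => // _; rewrite expr0n sqr_ge0.
Qed.

Lemma sum_mxtens (V : nmodType) a b (F : 'I_(a * b) -> V) :
  \sum_j F j = \sum_(i < a) \sum_(k < b) F (mxtens_index (i, k)).
Proof.
rewrite pair_bigA/=; apply: (reindex (fun ik : 'I_a * 'I_b => mxtens_index (ik.1, ik.2))).
exists (@mxtens_unindex a b) => [[i k]|j] _; first by rewrite mxtens_indexK.
by rewrite -surjective_pairing mxtens_unindexK.
Qed.

Lemma norm2_tens a b (v : 'cV[R]_(a * b)) :
  norm2 v ^+ 2 = \sum_(i < a) \sum_(k < b) v (mxtens_index (i, k)) 0 ^+ 2.
Proof. by rewrite norm2_sqr sum_mxtens. Qed.

Lemma tensmx1_mulE a b n (c : R) (M : 'M[R]_(a, b)) (x : 'cV[R]_(b * n))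
    (i : 'I_a) (k : 'I_n) :
  ((c *: (M *t (1%:M : 'M[R]_n))) *m x) (mxtens_index (i, k)) 0 =
  c * \sum_(j < b) M i j * x (mxtens_index (j, k)) 0.
Proof.
rewrite -scalemxAl mxE; congr (_ * _); rewrite mxE sum_mxtens.
apply: eq_bigr => j _; rewrite (bigD1 k)//= tensmxE mxE eqxx mulr1.
rewrite big1 ?addr0// => l lk; rewrite tensmxE [_%:M _ _]mxE eq_sym (negbTE lk).
by rewrite mulr0 mul0r.
Qed.

End Euclid.

Section Edges.
Variable n : nat.

Lemma src_subproof (e : 'I_n.-1) : (e < n)%N.
Proof. by have := ltn_ord e; lia. Qed.

Lemma dst_subproof (e : 'I_n.-1) : (e.+1 < n)%N.
Proof. by have := ltn_ord e; lia. Qed.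

Definition src e := Ordinal (src_subproof e).
Definition dst e := Ordinal (dst_subproof e).

End Edges.

Lemma sum_src_dst_le (R : realType) n (f : 'I_n -> R) : (forall i, 0 <= f i) ->
  \sum_(e < n.-1) f (src e) <= \sum_(i < n) f i /\
  \sum_(e < n.-1) f (dst e) <= \sum_(i < n) f i.
Proof.
case: n f => [|n] f f0; first by rewrite !big_ord0.
split.
  rewrite [leRHS]big_ord_recr/= -[leLHS]addr0 lerD//.
  by apply: ler_sum => e _; rewrite (_ : @src n.+1 e = widen_ord (leqnSn n) e)//;
    exact: val_inj.
rewrite [leRHS]big_ord_recl/= -[leLHS]add0r lerD//.
by apply: ler_sum => e _; rewrite (_ : @dst n.+1 e = lift ord0 e)//; exact: val_inj.
Qed.

(** * Incidence operators of the path and the spectrum of the stacked matrix *)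

Section Network.
Context {R : realType}.
Variables (Lf : R) (m1 m2 dbar : nat).
Local Notation m := (mm m1 m2).
Local Notation J := (@Jmx R m1 m2).
Implicit Types (S : {set 'I_m.-1}).

(** For [S] equal to [setM] this is [instAbar], and for its complement [instA], both by unfolding; a
    general [S] treats the two at once. *)
Definition edge_op S : 'M[R]_((#|S| * dbar)%N, (m * dbar)%N) :=
  (m%:R * Lf) *: (rowsub (@enum_val _ (mem S)) J *t (1%:M : 'M[R]_dbar)).

Lemma sum_Jmx (e : 'I_m.-1) (f : 'I_m -> R) :
  \sum_(i < m) J e i * f i = f (dst e) - f (src e).
Proof.
have ne : dst e != src e by rewrite -val_eqE /=; lia.
rewrite (bigD1 (src e))//= (bigD1 (dst e))//= !mxE /= eqxx mulN1r addrC.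
rewrite big1 ?addr0; last first.
  move=> i /andP[i1 i2]; rewrite mxE -!val_eqE/= in i1 i2 *.
  by rewrite (negbTE i1) (negbTE i2) mul0r.
by rewrite ifN ?eqxx ?mul1r//; lia.
Qed.

(** An edge with both ends in the prefix contributes $-1+1$ and an edge outside contributes nothing;
    only the edge leaving the prefix remains, through its source. *)
Lemma sum_Jmx_prefix (e e0 : 'I_m.-1) :
  \sum_(i < m | (i <= e0)%N) J e i = - (e == e0)%:R.
Proof.
rewrite big_mkcond (eq_bigr (fun i : 'I_m => J e i * (i <= e0)%N%:R)); last first.
  by move=> i _; case: ifP; rewrite ?mulr1 ?mulr0.
rewrite (sum_Jmx e (fun i => (i <= e0)%N%:R))/= -val_eqE/=.
by case: (ltngtP e e0) => _; rewrite ?subrr ?oppr0 ?sub0r ?subr0.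
Qed.

Lemma edge_op_mul S (x : 'cV[R]_(m * dbar)) (r : 'I_#|S|) (k : 'I_dbar) :
  (edge_op S *m x) (mxtens_index (r, k)) 0 = m%:R * Lf *
   (x (mxtens_index (dst (enum_val r), k)) 0
    - x (mxtens_index (src (enum_val r), k)) 0).
Proof.
rewrite tensmx1_mulE; congr (_ * _).
under eq_bigr do rewrite mxE.
by rewrite (sum_Jmx _ (fun i => x (mxtens_index (i, k)) 0)).
Qed.

Lemma edge_op_trmul S (z : 'cV[R]_(#|S| * dbar)) (i : 'I_m) (k : 'I_dbar) :
  ((edge_op S)^T *m z) (mxtens_index (i, k)) 0 =
  m%:R * Lf * \sum_(r < #|S|) J (enum_val r) i * z (mxtens_index (r, k)) 0.
Proof.
rewrite linearZ/= trmx_tens trmx1 tensmx1_mulE; congr (_ * _).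
by apply: eq_bigr => r _; rewrite !mxE.
Qed.

(* Summing over the vertices i <= e0 inverts the transposed incidence matrix of
   the path. *)
Lemma edge_op_trmul_prefix S (z : 'cV[R]_(#|S| * dbar)) (e0 : 'I_m.-1) (k : 'I_dbar) :
  \sum_(i < m | (i <= e0)%N) ((edge_op S)^T *m z) (mxtens_index (i, k)) 0 =
  - (m%:R * Lf * \sum_(r < #|S| | enum_val r == e0) z (mxtens_index (r, k)) 0).
Proof.
under eq_bigr do rewrite edge_op_trmul.
rewrite -mulr_sumr exchange_big/= -mulrN; congr (_ * _).
rewrite [in RHS]big_mkcond -sumrN; apply: eq_bigr => r _.
by rewrite -mulr_suml sum_Jmx_prefix; case: eqP => _; rewrite ?mulN1r ?oppr0 ?mul0r.
Qed.

Lemma edge_op_trmul_total S (z : 'cV[R]_(#|S| * dbar)) (k : 'I_dbar) :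
  \sum_(i < m) ((edge_op S)^T *m z) (mxtens_index (i, k)) 0 = 0.
Proof.
under eq_bigr do rewrite edge_op_trmul.
rewrite -mulr_sumr exchange_big/= big1 ?mulr0// => r _.
rewrite -mulr_suml; under eq_bigr do rewrite -[J _ _]mulr1.
by rewrite (sum_Jmx _ (fun=> 1)) subrr mul0r.
Qed.

Lemma sum_enum_val_mem S (z : 'I_#|S| -> R) (r0 : 'I_#|S|) :
  \sum_(r < #|S| | enum_val r == enum_val r0) z r = z r0.
Proof.
rewrite (eq_bigl (pred1 r0)) ?big_pred1_eq// => r /=.
by rewrite (inj_eq enum_val_inj).
Qed.

Lemma sum_enum_val_notin S (z : 'I_#|S| -> R) (e : 'I_m.-1) : e \notin S ->
  \sum_(r < #|S| | enum_val r == e) z r = 0.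
Proof.
move=> eS; rewrite big_pred0// => r; apply/eqP => re.
by move: eS; rewrite -re enum_valP.
Qed.

Lemma sum_enum_valC S (F : 'I_m.-1 -> R) :
  \sum_(r < #|S|) F (enum_val r) + \sum_(r < #|~: S|) F (enum_val r) =
  \sum_e F e.
Proof.
rewrite -!big_enum_val [RHS](bigID (mem S))/=; congr (_ + _).
by apply: eq_bigl => e; rewrite inE.
Qed.

Lemma edge_op_norm S (x : 'cV[R]_(m * dbar)) :
  norm2 (edge_op S *m x) ^+ 2 + norm2 (edge_op (~: S) *m x) ^+ 2 =
  (m%:R * Lf) ^+ 2 * \sum_(e < m.-1) \sum_(k < dbar)
   (x (mxtens_index (dst e, k)) 0 - x (mxtens_index (src e, k)) 0) ^+ 2.
Proof.
have E T : norm2 (edge_op T *m x) ^+ 2 =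
  \sum_(r < #|T|) ((m%:R * Lf) ^+ 2 * \sum_(k < dbar)
   (x (mxtens_index (dst (enum_val r), k)) 0
    - x (mxtens_index (src (enum_val r), k)) 0) ^+ 2).
  rewrite norm2_tens; apply: eq_bigr => r _; rewrite mulr_sumr.
  by apply: eq_bigr => k _; rewrite edge_op_mul exprMn.
by rewrite !E -!mulr_sumr -mulrDr (sum_enum_valC S (fun e => \sum_(k < dbar)
   (x (mxtens_index (dst e, k)) 0 - x (mxtens_index (src e, k)) 0) ^+ 2)).
Qed.

(** Uses $(a-b)^2 \le 2a^2+2b^2$ on each edge; every vertex is the source of at most one edge and
    the target of at most one. *)
Lemma edge_op_norm_le S (x : 'cV[R]_(m * dbar)) :
  norm2 (edge_op S *m x) ^+ 2 + norm2 (edge_op (~: S) *m x) ^+ 2 <=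
  4 * (m%:R * Lf) ^+ 2 * norm2 x ^+ 2.
Proof.
rewrite edge_op_norm norm2_tens -[leRHS]mulrA [leRHS]mulrCA ler_wpM2l ?sqr_ge0//.
have [s1 s2] := sum_src_dst_le
  (f := fun i => \sum_(k < dbar) x (mxtens_index (i, k)) 0 ^+ 2)
  (fun i => sumr_ge0 _ (fun k _ => sqr_ge0 _)).
apply: (@le_trans _ _ (\sum_(e < m.-1)
   (2 * \sum_(k < dbar) x (mxtens_index (dst e, k)) 0 ^+ 2 +
    2 * \sum_(k < dbar) x (mxtens_index (src e, k)) 0 ^+ 2))).
  apply: ler_sum => e _; rewrite !mulr_sumr -big_split/=.
  apply: ler_sum => k _; rewrite -subr_ge0.
  set a := x _ _; set b := x _ _.
  have -> : 2 * a ^+ 2 + 2 * b ^+ 2 - (a - b) ^+ 2 = (a + b) ^+ 2 by ring.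
  exact: sqr_ge0.
by rewrite big_split/= -!mulr_sumr; move: s1 s2 => /=; lra.
Qed.

(** Each entry of [z1] or [z2] is, up to the factor $mL_f$, a prefix sum of [w], so Cauchy-Schwarz
    bounds $mL_f^2$ times its square by the sum of squares of [w] in that coordinate. Summing over
    the fewer than $m$ edges cancels the factor $m$. *)
Lemma stacked_trmul_norm_ge S (z1 : 'cV[R]_(#|S| * dbar))
    (z2 : 'cV[R]_(#|~: S| * dbar)) : 0 < Lf -> (0 < m)%N ->
  Lf ^+ 2 * (norm2 z1 ^+ 2 + norm2 z2 ^+ 2) <=
  norm2 ((edge_op S)^T *m z1 + (edge_op (~: S))^T *m z2) ^+ 2.
Proof.
move=> Lf0 m0; set w := _ *m _ + _.
pose W k := \sum_(i < m) w (mxtens_index (i, k)) 0 ^+ 2.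
have M0 : 0 < m%:R :> R by rewrite ltr0n.
have pre (e : 'I_m.-1) k : \sum_(i < m | (i <= e)%N) w (mxtens_index (i, k)) 0 =
    - (m%:R * Lf * (\sum_(r < #|S| | enum_val r == e) z1 (mxtens_index (r, k)) 0
     + \sum_(r < #|~: S| | enum_val r == e) z2 (mxtens_index (r, k)) 0)).
  under eq_bigr do rewrite mxE.
  by rewrite big_split/= !edge_op_trmul_prefix -opprD -mulrDr.
have b (e : 'I_m.-1) k t : \sum_(r < #|S| | enum_val r == e) z1 (mxtens_index (r, k)) 0
     + \sum_(r < #|~: S| | enum_val r == e) z2 (mxtens_index (r, k)) 0 = t ->
    (m%:R * Lf ^+ 2) * t ^+ 2 <= W k.
  move=> tE; have := sqr_sum_cond_le (fun i : 'I_m => (i <= e)%N)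
    (fun i => w (mxtens_index (i, k)) 0).
  rewrite pre tE sqrrN -/(W k) => H.
  rewrite -(ler_pM2l M0) (le_trans _ H)//.
  by rewrite le_eqVlt; apply/orP; left; apply/eqP; ring.
have b1 r k : (m%:R * Lf ^+ 2) * z1 (mxtens_index (r, k)) 0 ^+ 2 <= W k.
  apply: (b (enum_val r)).
  rewrite sum_enum_val_mem (sum_enum_val_notin (S := ~: S)) ?addr0//.
  by rewrite inE negbK enum_valP.
have b2 r k : (m%:R * Lf ^+ 2) * z2 (mxtens_index (r, k)) 0 ^+ 2 <= W k.
  apply: (b (enum_val r)).
  rewrite sum_enum_val_mem (sum_enum_val_notin (S := S)) ?add0r//.
  by have := enum_valP r; rewrite inE.
have Wsum : \sum_(k < dbar) W k = norm2 w ^+ 2.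
  by rewrite norm2_tens exchange_big.
have c1 : (m%:R * Lf ^+ 2) * norm2 z1 ^+ 2 <= #|S|%:R * norm2 w ^+ 2.
  rewrite norm2_tens mulr_sumr -Wsum [#|S|%:R * _]mulr_natl
    -[#|S| in leRHS]card_ord -sumr_const.
  by apply: ler_sum => r _; rewrite mulr_sumr; apply: ler_sum => k _; exact: b1.
have c2 : (m%:R * Lf ^+ 2) * norm2 z2 ^+ 2 <= #|~: S|%:R * norm2 w ^+ 2.
  rewrite norm2_tens mulr_sumr -Wsum [#|~: S|%:R * _]mulr_natl
    -[#|~: S| in leRHS]card_ord -sumr_const.
  by apply: ler_sum => r _; rewrite mulr_sumr; apply: ler_sum => k _; exact: b2.
rewrite -(ler_pM2l M0); apply: (@le_trans _ _ ((#|S| + #|~: S|)%:R * norm2 w ^+ 2)).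
  by rewrite natrD mulrDl; apply: le_trans _ (lerD c1 c2); rewrite -mulrDr mulrA.
by rewrite ler_wpM2r ?sqr_ge0// ler_nat cardsC card_ord leq_pred.
Qed.

(** Every eigenvalue of $HH^\top$ lies between $L_f^2$ and $4(mL_f)^2$, the lower end by
    [stacked_trmul_norm_ge] and the upper one by [edge_op_norm_le]. *)
Lemma kappa_stacked_le S : 0 < Lf -> (0 < m)%N ->
  kappa (col_mx (edge_op S) (edge_op (~: S))) <= 2 * m%:R.
Proof.
move=> Lf0 m0; set H := col_mx _ _.
have M0 : 0 < m%:R :> R by rewrite ltr0n.
have ev a : eigenvalue (H *m H^T) a -> Lf ^+ 2 <= a <= 4 * (m%:R * Lf) ^+ 2.
  move=> /eigenvalueP[v vE v0].
  pose g := v^T; have gE : H *m (H^T *m g) = a *: g.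
    have HT : (H *m H^T)^T = H *m H^T by rewrite trmx_mul trmxK.
    by rewrite mulmxA -HT /g -trmx_mul vE linearZ.
  pose w := H^T *m g.
  have wE : w = (edge_op S)^T *m usubmx g + (edge_op (~: S))^T *m dsubmx g.
    by rewrite /w /H tr_col_mx -mul_row_col vsubmxK.
  have gs : norm2 g ^+ 2 = norm2 (usubmx g) ^+ 2 + norm2 (dsubmx g) ^+ 2.
    rewrite !norm2_sqr big_split_ord/=; congr (_ + _);
    by apply: eq_bigr => i _; rewrite [in RHS]mxE.
  have g0 : 0 < norm2 g ^+ 2.
    rewrite exprn_gt0// lt_neqAle norm2_ge0 andbT eq_sym.
    apply/eqP => /norm2_eq0 g0; move: v0.
    by rewrite -[v]trmxK -/g g0 trmx0 eqxx.
  have wg : norm2 w ^+ 2 = a * norm2 g ^+ 2.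
    rewrite -norm2_trmul /w trmx_mul (trmxK H) -mulmxA gE -scalemxAr mxE.
    by rewrite norm2_trmul.
  have lo : Lf ^+ 2 <= a.
    by rewrite -(ler_pM2r g0) -wg wE gs; exact: stacked_trmul_norm_ge.
  rewrite lo/=.
  have a0 : 0 < a by rewrite (lt_le_trans _ lo)// exprn_gt0.
  (* For an eigenvector [g], applying $H$ to $w = H^\top g$ gives $ag$, and $\|w\|^2 = a\|g\|^2$;
     dividing by $a\|g\|^2$ leaves the upper bound on [a]. *)
  have Hw : a ^+ 2 * norm2 g ^+ 2 <= 4 * (m%:R * Lf) ^+ 2 * norm2 w ^+ 2.
    apply: le_trans (edge_op_norm_le S w).
    have -> : a ^+ 2 * norm2 g ^+ 2 = norm2 (H *m w) ^+ 2.
      rewrite /w gE !norm2_sqr mulr_sumr; apply: eq_bigr => i _.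
      by rewrite [in RHS]mxE exprMn.
    rewrite /H mul_col_mx norm2_sqr big_split_ord/= !norm2_sqr.
    by under eq_bigr do rewrite col_mxEu; under [X in _ + X]eq_bigr do rewrite col_mxEd.
  rewrite -(ler_pM2r (mulr_gt0 a0 g0)).
  by rewrite [leLHS]mulrA -expr2 (le_trans Hw)// wg.
have lmax : 0 <= lambda_max (H *m H^T) <= 4 * (m%:R * Lf) ^+ 2.
  rewrite /lambda_max; set E := (X in sup X).
  have [->|/set0P [a Ea]] := eqVneq E set0.
    by rewrite sup0 lexx/= mulr_ge0// sqr_ge0.
  have ub : ubound E (4 * (m%:R * Lf) ^+ 2) by move=> b /ev/andP[].
  rewrite ge_sup//; last by exists a.
  rewrite andbT (@le_trans _ _ a)//.
    by have /andP[+ _] := ev _ Ea; apply: le_trans; rewrite sqr_ge0.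
  by apply: ub_le_sup => //; exists (4 * (m%:R * Lf) ^+ 2).
(* The infimum of the empty set is 0, and division by 0 yields 0; [kappa] is then 0 and the bound is
   trivial. *)
rewrite /kappa; have [l0|/eqP l0] := pselect (lambda_min (H *m H^T) = 0).
  by rewrite l0 invr0 mulr0 sqrtr0 mulr_ge0.
have lmin : Lf ^+ 2 <= lambda_min (H *m H^T).
  move: l0; rewrite /lambda_min; set E := (X in inf X).
  have [->|/set0P E0 _] := eqVneq E set0; first by rewrite inf0 eqxx.
  by apply: lb_le_inf => // b [/ev/andP[]].
rewrite -[leRHS]ger0_norm ?mulr_ge0// -sqrtr_sqr ler_sqrt ?sqr_ge0//.
have L2 : 0 < Lf ^+ 2 by rewrite exprn_gt0.
rewrite ler_pdivrMr ?(lt_le_trans L2)//.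
have /andP[_ l1] := lmax; apply: le_trans l1 _.
have -> : 4 * (m%:R * Lf) ^+ 2 = (2 * m%:R) ^+ 2 * Lf ^+ 2 by ring.
by rewrite ler_wpM2l ?sqr_ge0.
Qed.

End Network.

(** * Smoothness of the instance *)

Section Coordinates.
Context {R : realType}.

Lemma coor_ord n (z : 'cV[R]_n) (k : 'I_n) : coor z k.+1 = z k 0.
Proof. by rewrite /coor/= valK. Qed.

Lemma coor_geq n (z : 'cV[R]_n) k : (n <= k)%N -> coor z k.+1 = 0.
Proof. by move=> nk; rewrite /coor/= insubF// ltnNge nk. Qed.

Lemma coor_scale n (s : R) (z : 'cV[R]_n) j : coor (s *: z) j = s * coor z j.
Proof. by rewrite /coor; case: insubP => [k _ _|_]; rewrite ?mxE ?mulr0. Qed.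

Lemma has_differential_entry m n (x : 'M[R]_(m, n)) i j :
  has_differential (fun y : 'M[R]_(m, n) => y i j) x (fun v => v i j).
Proof.
split=> [|v]; first exact: differentiable_coord.
have /derive_mx /matrixP /(_ i j) : derivable (@id 'M[R]_(m, n)) x v by [].
by rewrite derive_id mxE.
Qed.

Lemma subcE n (u v : 'cV[R]_n) i : (u - v) i 0 = u i 0 - v i 0.
Proof. by rewrite !mxE. Qed.

Lemma norm1_ge0 n (y : 'cV[R]_n) : 0 <= norm1 y.
Proof. by apply: sumr_ge0 => i _; exact: normr_ge0. Qed.

Lemma norm1_continuous n : continuous (@norm1 R n).
Proof.
apply: continuous_big => [|i _]; first exact: add_continuous.
move=> x; apply: (@continuous_comp _ _ _ (fun y : 'cV[R]_n => y i 0) (@Num.norm _ R)).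
  exact: coord_continuous.
exact: (@norm_continuous _ R^o).
Qed.

Lemma lower_semicontinuous_EFin (T : topologicalType) (f : T -> R) :
  continuous f -> lower_semicontinuous (EFin \o f).
Proof.
move=> cf x a /=; rewrite lte_fin => afx.
exists [set y | a < f y]%classic; first exact: cvgr_gt (cf x) _ afx.
by move=> y /=; rewrite lte_fin.
Qed.

Lemma norm1_convex n (x y : 'cV[R]_n) (s : R) : 0 <= s <= 1 ->
  norm1 (s *: x + (1 - s) *: y) <= s * norm1 x + (1 - s) * norm1 y.
Proof.
move=> /andP[s0 s1]; rewrite /norm1 !mulr_sumr -big_split/=.
apply: ler_sum => i _; rewrite !mxE; apply: le_trans (ler_normD _ _) _.
by rewrite !normrM (ger0_norm s0) (ger0_norm (_ : 0 <= 1 - s)) ?subr_ge0.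
Qed.

End Coordinates.

Section Instance.
Context {R : realType}.
Variables (eps Lf beta : R) (m1 m2 dbar : nat).
Hypotheses (eps_gt0 : 0 < eps) (Lf_gt0 : 0 < Lf) (beta_ge0 : 0 <= beta).
Hypotheses (m_gt0 : (0 < mm m1 m2)%N) (dbar_gt0 : (0 < dbar)%N) (dbar_odd : odd dbar).
Local Notation m := (mm m1 m2).
Local Notation P := (instP eps Lf beta m1 m2 dbar).
Implicit Types (x : 'cV[R]_(m * dbar)).

Let M_gt0 : 0 < m%:R :> R. Proof. by rewrite ltr0n. Qed.

Definition out_scale : R := 300 * pi * eps ^+ 2 / (m%:R * Lf).
Definition in_scale : R := Num.sqrt m%:R * Lf / (150 * pi * eps).

Definition scaled_block x (i : 'I_m) (k : nat) : R :=
  in_scale * coor (block x i) k.+1.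

Lemma scaled_blockE x i (k : 'I_dbar) :
  scaled_block x i k = in_scale * x (mxtens_index (i, k)) 0.
Proof. by rewrite /scaled_block coor_ord mxE. Qed.

Lemma scaled_block_geq x i k : (dbar <= k)%N -> scaled_block x i k = 0.
Proof. by move=> ?; rewrite /scaled_block coor_geq// mulr0. Qed.

Lemma sqrt_m_gt0 : 0 < Num.sqrt m%:R :> R.
Proof. by rewrite sqrtr_gt0. Qed.

Lemma out_scale_gt0 : 0 < out_scale.
Proof.
apply: divr_gt0; last exact: mulr_gt0.
apply: mulr_gt0; last exact: exprn_gt0.
by apply: mulr_gt0; [exact: ltr0n|exact: pi_gt0].
Qed.

Lemma out_in_scale : out_scale * in_scale = 2 * eps / Num.sqrt m%:R.
Proof.
rewrite /out_scale /in_scale; have := sqr_sqrtr (ltW M_gt0).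
move: sqrt_m_gt0; move: (Num.sqrt _) => q q0 qq; rewrite -qq.
have := @pi_gt0 R; move: (@pi R) => w w0.
by field; rewrite !gt_eqF.
Qed.

(** Rescaling multiplies the Lipschitz constant $75\pi$ of [dchain] by [out_scale * in_scale ^+ 2],
    so the scales are tuned to give exactly [Lf]. *)
Lemma out_in_scale_sqr : out_scale * in_scale ^+ 2 * (75 * pi) = Lf.
Proof.
rewrite expr2 [out_scale * _]mulrA out_in_scale /in_scale.
have := @pi_gt0 R; have := sqrt_m_gt0; move: (@pi R) (Num.sqrt _) => w q q0 w0.
by field; rewrite !gt_eqF.
Qed.

Lemma instf0E x :
  instf0 eps Lf x = out_scale * \sum_(i < m) chain m1 m2 dbar i (scaled_block x i).
Proof.
rewrite /instf0 mulr_sumr; apply: eq_bigr => i _.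
rewrite /instf -/out_scale -/in_scale h_chain//; congr (_ * chain _ _ _ _ _).
by apply/funext => k; rewrite coor_scale.
Qed.

Lemma has_differential_scaled_block i k x :
  has_differential (fun y => scaled_block y i k) x (fun v => scaled_block v i k).
Proof.
case: (ltnP k dbar) => kd; last first.
  have E y : scaled_block y i k = 0 by exact: scaled_block_geq.
  under eq_fun do rewrite E.
  exact: has_differential_cst.
have E y : scaled_block y i k = in_scale * y (mxtens_index (i, Ordinal kd)) 0.
  by rewrite -scaled_blockE.
under eq_fun do rewrite E.
exact: has_differentialZ (has_differential_entry _ _ _).
Qed.

(** The [link2] terms are reindexed by the coordinate they differentiate; nothing is lost at the end
    of the range because the last coefficient is 0. *)
Lemma sum_dchain i (z v : nat -> R) :
  - Psi 1 * (dPhi (z 0%N) * v 0%N) +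
  \sum_(k < dbar) coef m1 m2 dbar i k *
     (link1 (z k) (z k.+1) * v k + link2 (z k) (z k.+1) * v k.+1)
  = \sum_(k < dbar) dchain m1 m2 dbar i z k * v k.
Proof.
have ltd : coef m1 m2 dbar i dbar.-1 = 0 :> R by rewrite /coef prednK// ltnn.
rewrite /dchain; move: (coef m1 m2 dbar i) ltd => c.
move: dbar_gt0; case: (dbar) => // n _ /= cn.
under eq_bigr do rewrite mulrDr.
under [RHS]eq_bigr do rewrite !mulrDl.
rewrite !big_split/= -addrA; congr (_ + (_ + _)).
- rewrite big_ord_recl/= big1 ?addr0; first by ring.
  by move=> k _; rewrite mul0r.
- by apply: eq_bigr => k _; rewrite mulrA.
- rewrite big_ord_recr/= cn mul0r addr0 [RHS]big_ord_recl/= mul0r add0r.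
  by apply: eq_bigr => k _; rewrite mulrA.
Qed.

Lemma has_differential_instf0 x :
  has_differential (@instf0 R eps Lf m1 m2 dbar) x (fun v => out_scale *
    \sum_(i < m) \sum_(k < dbar)
      dchain m1 m2 dbar i (scaled_block x i) k * scaled_block v i k).
Proof.
rewrite (_ : @instf0 R eps Lf m1 m2 dbar = fun y => out_scale *
   \sum_(i < m) chain m1 m2 dbar i (scaled_block y i)); last first.
  by apply/funext => y; exact: instf0E.
apply: has_differentialZ.
apply: (has_differential_sum (F := fun (i : 'I_m) y => chain m1 m2 dbar i (scaled_block y i))
  (dF := fun (i : 'I_m) v => \sum_(k < dbar)
      dchain m1 m2 dbar i (scaled_block x i) k * scaled_block v i k)) => i.
under [X in has_differential _ _ X]eq_fun do rewrite -sum_dchain.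
apply: has_differentialD.
  apply: has_differentialZ; apply: has_differential_comp; first exact: is_derive_Phi.
  exact: has_differential_scaled_block.
apply: (has_differential_sum
  (F := fun (k : 'I_dbar) y => coef m1 m2 dbar i k *
          link (scaled_block y i k) (scaled_block y i k.+1))
  (dF := fun (k : 'I_dbar) v => coef m1 m2 dbar i k *
      (link1 (scaled_block x i k) (scaled_block x i k.+1) * scaled_block v i k
       + link2 (scaled_block x i k) (scaled_block x i k.+1) * scaled_block v i k.+1))) => k.
by apply: has_differentialZ; apply: has_differential_link;
  exact: has_differential_scaled_block.
Qed.

Lemma grad_instf0 x (i : 'I_m) (k : 'I_dbar) :
  grad (@instf0 R eps Lf m1 m2 dbar) x (mxtens_index (i, k)) 0 =
  out_scale * in_scale * dchain m1 m2 dbar i (scaled_block x i) k.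
Proof.
have [_ D] := has_differential_instf0 x.
rewrite mxE D -mulrA; congr (_ * _); rewrite mulrC.
have E j l : scaled_block (delta_mx (mxtens_index (i, k)) 0) j (val l) =
    in_scale * ((j == i) && (l == k))%:R.
  rewrite scaled_blockE mxE andbT; congr (_ * (nat_of_bool _)%:R).
  by rewrite (can_eq (@mxtens_indexK m dbar)).
rewrite (bigD1 i)//= [X in _ + X]big1 ?addr0; last first.
  move=> j ji; rewrite big1// => l _.
  by rewrite E (negbTE ji) mulr0 mulr0.
rewrite (bigD1 k)//= [X in _ + X]big1 ?addr0; last first.
  by move=> l lk; rewrite E (negbTE lk) andbF mulr0 mulr0.
by rewrite E !eqxx mulr1.
Qed.

Lemma grad_instf0_lipschitz x x' :
  norm2 (grad (@instf0 R eps Lf m1 m2 dbar) x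
         - grad (@instf0 R eps Lf m1 m2 dbar) x') <= Lf * norm2 (x - x').
Proof.
move: (grad _) grad_instf0 => g G.
have r0 : 0 <= Lf * norm2 (x - x') by rewrite mulr_ge0 ?norm2_ge0 ?ltW.
rewrite -(ler_pXn2r (_ : 0 < 2)%N) ?nnegrE ?norm2_ge0// exprMn !norm2_tens.
rewrite mulr_sumr; apply: ler_sum => i _.
have := @dchain_lipschitz R m1 m2 dbar i (scaled_block x i) (scaled_block x' i).
rewrite !scaled_block_geq// => /(_ erefl) H.
have -> : \sum_(k < dbar) (g x - g x') (mxtens_index (i, k)) 0 ^+ 2
  = (out_scale * in_scale) ^+ 2 * \sum_(k < dbar)
     (dchain m1 m2 dbar i (scaled_block x i) k
      - dchain m1 m2 dbar i (scaled_block x' i) k) ^+ 2.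
  rewrite mulr_sumr; apply: eq_bigr => k _.
  by rewrite subcE !G -mulrBr exprMn.
apply: le_trans (ler_wpM2l (sqr_ge0 _) H) _.
rewrite le_eqVlt; apply/orP; left; apply/eqP.
rewrite -[in RHS]out_in_scale_sqr mulrA !mulr_sumr; apply: eq_bigr => k _.
by rewrite !scaled_blockE !mxE; ring.
Qed.

Lemma assumption1ac_instP : assumption1ac Lf P.
Proof.
have c0 : 0 <= beta / (m%:R * Lf) by rewrite divr_ge0// mulr_ge0 ?ltW.
split.
- by move=> x; have [] := has_differential_instf0 x.
- exact: grad_instf0_lipschitz.
- by split=> [y|]; rewrite /= /instgbar//; exists 0.
- apply: (@lower_semicontinuous_EFin _ _ (fun y => beta / (m%:R * Lf) * norm1 y)).
  move=> y; apply: (@continuousM _ _ (cst _) (@norm1 R _)).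
    exact: cst_continuous.
  exact: norm1_continuous.
- move=> x y s s01; rewrite /= /instgbar -!EFinM -EFinD lee_fin.
  have -> : s * (beta / (m%:R * Lf) * norm1 x) + (1 - s) * (beta / (m%:R * Lf) * norm1 y)
    = beta / (m%:R * Lf) * (s * norm1 x + (1 - s) * norm1 y) by ring.
  by rewrite ler_wpM2l// norm1_convex.
Qed.


End Instance.

(** * Change of variables *)

Section Translation.
Context {R : realType} {d n nbar : nat}.
Implicit Types (P : SP R d n nbar) (u x : 'cV[R]_d) (v y : 'cV[R]_nbar).

(** Turns the span assumption centred at the starting point, stated for a translated problem, into
    the plain one for the original problem. *)
Lemma translateK P u v : translate (translate P u v) (- u) (- v) = P.
Proof.
case: P => f g A b B c; rewrite /translate/=; congr MkSP.
- by apply/funext => x; rewrite opprK addrK.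
- by apply/funext => y; rewrite opprK addrK.
- by rewrite mulmxN opprK subrK.
- by rewrite mulmxN opprK addrAC subrK addrK.
Qed.

Lemma grad_translate (f : 'cV[R]_d -> R) u x :
  grad (fun t => f (t - u)) x = grad f (x - u).
Proof.
apply/matrixP => i j; rewrite !mxE /derive.
apply: (congr1 (fun F : R -> R => lim (F @ 0^')%classic)).
by apply/funext => h; rewrite /= addrA.
Qed.

Lemma assumption1ac_translate Lf P u v :
  assumption1ac Lf P -> assumption1ac Lf (translate P u v).
Proof.
move=> [fd fl [gN [y gy]] gl gc]; split => /=.
- by move=> x; apply: (@differentiable_comp _ _ _ _ (fun t => t - u)).
- move=> x x'; rewrite !grad_translate; apply: le_trans (fl _ _) _.
  by rewrite opprD opprK addrACA addNr addr0.
- by split=> [z|]; [exact: gN|exists (y + v); rewrite addrK].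
- move=> x a /gl[V Vx VP]; exists ((fun y => y - v) @^-1` V)%classic.
    have : {for x, continuous (fun y => y - v)}.
      by apply: (@continuousB _ _ _ id (cst v)); [exact: cvg_id|exact: cst_continuous].
    exact.
  by move=> z /VP.
- move=> x z s s01; have := gc (x - v) (z - v) s s01.
  suff -> : s *: x + (1 - s) *: z - v = s *: (x - v) + (1 - s) *: (z - v) by [].
  by rewrite !scalerBr addrACA -opprD -scalerDl [s + _]addrC subrK scale1r.
Qed.

Lemma infF_translate P u v : infF (translate P u v) = infF P.
Proof.
rewrite /infF; congr ereal_inf; apply/seteqP; split=> _ [[x y] _ <-] /=.
  by exists (x - u, y - v).
by exists (x + u, y + v) => //=; rewrite /objF/= !addrK.
Qed.

Lemma DeltaF_translate P u v : DeltaF (translate P u v) u v = DeltaF P 0 0.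
Proof. by rewrite /DeltaF infF_translate /objF/= !subrr. Qed.

Lemma eps_stationary_translate eps P u v x y :
  eps_stationary eps (translate P u v) x y -> eps_stationary eps P (x - u) (y - v).
Proof.
move=> [z1 [z2 [d1 d2 d3 d4]]]; exists z1, z2; split.
- suff <- : subdifferential (gbar (translate P u v)) y =
      subdifferential (gbar P) (y - v) by [].
  apply/seteqP; split=> w H z /=.
    have := H (z + v); rewrite /= addrK; congr (_ + (dot _ _)%:E <= _)%E.
    by rewrite opprB addrA.
  have := H (z - v); congr (_ + (dot _ _)%:E <= _)%E.
  by rewrite opprB addrA subrK.
- by rewrite -grad_translate.
- move: d3 => /=; congr (norm2 _ <= _); rewrite mulmxBr.
  move: (_ *m x) (_ *m u) => a c.
  by apply/matrixP => i j; rewrite !mxE; ring.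
- move: d4 => /=; congr (norm2 _ <= _); rewrite mulmxBr.
  move: (_ *m x) (_ *m u) => a c.
  by apply/matrixP => i j; rewrite !mxE; ring.
Qed.

End Translation.

(** * Objective gap and propagation of zeros *)

Section Objective.
Context {R : realType}.
Variables (eps Lf beta : R) (m1 m2 dbar : nat).
Hypotheses (eps_gt0 : 0 < eps) (Lf_gt0 : 0 < Lf) (beta_ge0 : 0 <= beta).
Hypotheses (m_gt0 : (0 < mm m1 m2)%N) (dbar_gt0 : (0 < dbar)%N) (dbar_odd : odd dbar).
Local Notation m := (mm m1 m2).
Local Notation P := (instP eps Lf beta m1 m2 dbar).

Let gap : R := out_scale eps Lf m1 m2 * (m%:R * (16 * pi * dbar%:R)).

Let out_ge0 : 0 <= out_scale eps Lf m1 m2.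
Proof. exact: ltW (out_scale_gt0 eps_gt0 Lf_gt0 m_gt0). Qed.

Let slope_ge0 : 0 <= beta / (m%:R * Lf).
Proof. by rewrite divr_ge0// mulr_ge0 ?(ltW Lf_gt0). Qed.

Lemma objF_instP_ge x y : ((- gap)%:E <= objF P x y)%E.
Proof.
rewrite /objF/= /instgbar -EFinD lee_fin instf0E//.
have gy : 0 <= beta / (m%:R * Lf) * norm1 y by rewrite mulr_ge0 ?norm1_ge0.
have f0 : m%:R * (- (16 * pi * dbar%:R)) <=
    \sum_(i < m) chain m1 m2 dbar i (scaled_block eps Lf x i).
  rewrite mulr_natl -[m in _ *+ m]card_ord -sumr_const.
  by apply: ler_sum => i _; exact: chain_ge.
rewrite /gap -mulrN -mulrN; apply: (le_trans (ler_wpM2l out_ge0 f0)).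
by rewrite lerDl.
Qed.

Lemma objF_instP0_le0 : (objF P 0 0 <= 0)%E.
Proof.
rewrite /objF/= /instgbar -EFinD lee_fin instf0E//.
rewrite [norm1 0]big1 ?mulr0 ?addr0; last by move=> i _; rewrite mxE normr0.
rewrite mulr_ge0_le0// sumr_le0// => i _.
rewrite (_ : scaled_block eps Lf 0 i = fun=> 0) ?chain0_le0//.
apply/funext => k; case: (ltnP k dbar) => kd; last exact: scaled_block_geq.
by rewrite (scaled_blockE eps Lf 0 i (Ordinal kd)) mxE mulr0.
Qed.

Lemma infF_instP_ge : ((- gap)%:E <= infF P)%E.
Proof. by apply: le_ereal_inf_tmp => _ [[x y] _ <-]; exact: objF_instP_ge. Qed.

Lemma DeltaF_instP_le : DeltaF P 0 0 <= 4800 * pi ^+ 2 * eps ^+ 2 * dbar%:R / Lf.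
Proof.
have -> : 4800 * pi ^+ 2 * eps ^+ 2 * dbar%:R / Lf = gap.
  have M0 : 0 < m%:R :> R by rewrite ltr0n.
  rewrite /gap /out_scale; move: (@pi R) => w; field.
  by rewrite !gt_eqF.
have inf_le : (infF P <= objF P 0 0)%E.
  by apply: ereal_inf_lbound; exists (0, 0).
have := infF_instP_ge; have := objF_instP0_le0; move: inf_le.
rewrite /DeltaF /objF/= /instgbar -EFinD.
(* Both infinite values are excluded, by the value at the origin and by the lower bound, so [fine]
   loses nothing. *)
case: (infF P) => [a| |]//.
by rewrite -EFinB !lee_fin /=; move: (_ + _) => c *; lra.
Qed.

(* Zeroing an entry of a minimiser lowers both terms of the prox objective. *)
Lemma prox_instgbar_eq0 eta (xi zeta : 'cV[R]_(#|setM m1 m2| * dbar)) j :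
  0 < eta -> prox eta (gbar P) xi zeta -> xi j 0 = 0 -> zeta j 0 = 0.
Proof.
move=> eta0 pz xj.
pose z := \col_i (if i == j then 0 else zeta i 0).
have := pz z; rewrite /= /instgbar -!EFinD lee_fin.
rewrite !norm2_sqr /norm1 (bigD1 j)//= [X in _ + _ * X](bigD1 j)//=.
rewrite [X in _ <= _ * X + _](bigD1 j)//= [X in _ <= _ + _ * X](bigD1 j)//=.
have -> : \sum_(i < #|setM m1 m2| * dbar | i != j) `|z i 0| =
    \sum_(i < #|setM m1 m2| * dbar | i != j) `|zeta i 0|.
  by apply: eq_bigr => i /negbTE ij; rewrite mxE ij.
have -> : \sum_(i < #|setM m1 m2| * dbar | i != j) (z - xi) i 0 ^+ 2 =
    \sum_(i < #|setM m1 m2| * dbar | i != j) (zeta - xi) i 0 ^+ 2.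
  by apply: eq_bigr => i /negbTE ij; rewrite !subcE mxE ij.
rewrite !subcE xj !subr0 mxE eqxx normr0 add0r expr0n add0r !mulrDr.
set A := _ * \sum_(i < _ | _) _; set B := _ * \sum_(i < _ | _) _ => H.
have Z1 : 0 <= beta / (m%:R * Lf) * `|zeta j 0| by rewrite mulr_ge0.
have Z2 : (2 * eta)^-1 * zeta j 0 ^+ 2 <= 0 by lra.
have e2 : 0 < (2 * eta)^-1 by rewrite invr_gt0 mulr_gt0.
move: Z2; rewrite pmulr_rle0// => Z2; apply/eqP.
by rewrite -sqrf_eq0 eq_le Z2 sqr_ge0.
Qed.

End Objective.

Lemma span_entry_eq0 (F : fieldType) n (X : seq 'cV[F]_n) v j : v \in <<X>>%VS ->
  (forall w, w \in X -> w j 0 = 0) -> v j 0 = 0.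
Proof.
move=> /(@coord_span _ _ _ (in_tuple X)) -> X0.
rewrite summxE big1// => i _; rewrite mxE X0 ?mulr0//.
by apply: mem_nth; exact: ltn_ord.
Qed.

(** * Speed at which nonzero coordinates spread along the path *)

Section Propagation.
Context {R : realType}.
Variables (eps Lf beta : R) (m1 m2 dbar : nat).
Hypotheses (eps_gt0 : 0 < eps) (Lf_gt0 : 0 < Lf) (beta_ge0 : 0 <= beta).
Hypotheses (m_gt0 : (0 < mm m1 m2)%N) (dbar_gt0 : (0 < dbar)%N) (dbar_odd : odd dbar).
Local Notation m := (mm m1 m2).
Local Notation p := (m1 * m2)%N.
Local Notation P := (instP eps Lf beta m1 m2 dbar).

(* A lower bound for the first iteration at which coordinate k of block i can
   be nonzero: odd coordinates (counted from 0) are born in the first third of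
   the path, even ones in the last third, and each has to cross the middle
   third before it can give birth to the next one. *)
Definition birth (i k : nat) : nat :=
  if k is l.+1 then
    (l * p + (if odd k then minn (i - p) p else p - minn (i - p) p))%N
  else 0%N.

(** The ramp [minn (i - p) p] changes by at most 1 from one block to the next. *)
Lemma birth_adjacent i i' k : (i <= i'.+1)%N -> (i' <= i.+1)%N ->
  (birth i k <= (birth i' k).+1)%N.
Proof.
case: k => // k ii' i'i; rewrite /birth.
by case: ifP => _; move: (k * p)%N p => q r; lia.
Qed.

(** Where the link leaving [k] is active, the ramp of coordinate [k] is complete and that of [k.+1]
    has not begun, so the two births coincide. *)
Lemma birth_next i k : coef m1 m2 dbar i k != 0 :> R ->
  (birth i k.+1 <= (birth i k).+1)%N.
Proof.
rewrite /coef; case: ifP => [|_]; last by rewrite eqxx.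
move=> /andP[_ H] _; case: k H => [|k] H; first by move: H => /=; lia.
have -> : birth i k.+2 = (k * p + p + (if odd k then minn (i - p) p
    else p - minn (i - p) p))%N.
  by rewrite /birth /= negbK mulSn [(p + _)%N]addnC.
move: H; rewrite /birth /=; case: (odd k) => /=; move: (k * p)%N p => q r; lia.
Qed.

(** Applied to the last coordinate [dbar.-1], which is even because [dbar] is odd; this is the
    source of the count $(\bar d-1)m/3$. *)
Lemma birth_first_block k : ~~ odd k -> birth 0 k = (k * p)%N.
Proof.
by case: k => //= k; rewrite negbK => ->; rewrite sub0n min0n subn0 mulSnr.
Qed.

Definition incident (e : 'I_m.-1) (i : 'I_m) := (i == src e) || (i == dst e).

Lemma incident_birth e i i' k : incident e i -> incident e i' ->
  (birth i k <= (birth i' k).+1)%N.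
Proof.
move=> /orP[]/eqP-> /orP[]/eqP->; apply: birth_adjacent => /=; lia.
Qed.

Lemma Jmx_incident (e : 'I_m.-1) (i : 'I_m) :
  ~~ incident e i -> @Jmx R m1 m2 e i = 0.
Proof.
by rewrite negb_or mxE -!val_eqE/= => /andP[/negbTE-> /negbTE->].
Qed.

Lemma edge_op_trmul_eq0 (S : {set 'I_m.-1}) (z : 'cV[R]_(#|S| * dbar))
    (i : 'I_m) (k : 'I_dbar) :
  (forall r, incident (enum_val r) i -> z (mxtens_index (r, k)) 0 = 0) ->
  ((edge_op Lf dbar S)^T *m z) (mxtens_index (i, k)) 0 = 0.
Proof.
move=> z0; rewrite edge_op_trmul big1 ?mulr0// => r _.
have [/z0->|/Jmx_incident->] := boolP (incident (enum_val r) i); first by rewrite mulr0.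
by rewrite mul0r.
Qed.

Lemma edge_op_mul_eq0 (S : {set 'I_m.-1}) (x : 'cV[R]_(m * dbar)) (r : 'I_#|S|) (k : 'I_dbar) :
  (forall i, incident (enum_val r) i -> x (mxtens_index (i, k)) 0 = 0) ->
  (edge_op Lf dbar S *m x) (mxtens_index (r, k)) 0 = 0.
Proof.
move=> x0; rewrite edge_op_mul !x0 ?subrr ?mulr0//.
  by rewrite /incident eqxx.
by rewrite /incident eqxx orbT.
Qed.

(** An edge entry of [y] is kept at 0 while either endpoint is unborn. This survives the induction
    because edge entries read block values from earlier iterations, and births across an edge differ
    by at most 1. In return, adding $\bar A^\top y$ to a block never brings a birth forward. *)
Lemma iterate_eq0 (x : nat -> 'cV[R]_(m * dbar))
    (y : nat -> 'cV[R]_(#|setM m1 m2| * dbar)) :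
  x 0%N = 0 -> y 0%N = 0 -> assumption3 P x y ->
  forall t, (forall (i : 'I_m) (k : 'I_dbar), (t < birth i k)%N ->
               x t (mxtens_index (i, k)) 0 = 0)
         /\ (forall r (k : 'I_dbar) i, incident (enum_val r) i ->
               (t < birth i k)%N -> y t (mxtens_index (r, k)) 0 = 0).
Proof.
move=> x0 y0 xy.
elim/ltn_ind => t IH; case: (posnP t) => [->|t0].
  by rewrite x0 y0; split=> *; rewrite mxE.
have [xt [xi [zeta [xiP [eta eta0 zetaP] yt]]]] := xy t t0.
have lt_pred s (i i' : 'I_m) (k : 'I_dbar) : (s < t)%N -> (t < birth i k)%N ->
    (birth i k <= (birth i' k).+1)%N -> (s < birth i' k)%N by lia.
split=> [i k tb|r k i ri tb].
  apply: (span_entry_eq0 xt) => w; rewrite mem_cat !inE -orbA => /or3P[/eqP->|/eqP->|].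
  - by rewrite mulmx0 mxE.
  - by rewrite mulmx0 mxE.
  move/flattenP => [_ /mapP[s + ->]]; rewrite mem_iota add0n => /andP[_ st].
  have [IHx IHy] := IH s st.
  have sb : (s < birth i k)%N by lia.
  rewrite !inE => /or4P[/eqP->|/eqP->|/eqP->|/orP[]/eqP->].
  - exact: IHx.
  - rewrite grad_instf0//.
    (* Coordinate 0 has birth 0, so [sb] excludes it; its derivative does not vanish at 0. *)
    have k0 : (0 < k)%N by case: (val k) sb.
    rewrite dchain_eq0 ?mulr0//; first by rewrite scaled_blockE IHx ?mulr0.
    have [c0|c0] := eqVneq (coef m1 m2 dbar i k.-1 : R) 0; [by left|right].
    have kd : (k.-1 < dbar)%N by have := ltn_ord k; lia.
    rewrite (scaled_blockE eps Lf (x s) i (Ordinal kd)) IHx ?mulr0//=.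
    by have := birth_next c0; rewrite prednK//; lia.
  - apply: edge_op_trmul_eq0 => r ri; apply: edge_op_mul_eq0 => i' ri'.
    by apply: IHx; apply: lt_pred st tb _; exact: incident_birth ri ri'.
  - apply: edge_op_trmul_eq0 => r ri; apply: edge_op_mul_eq0 => i' ri'.
    by apply: IHx; apply: lt_pred st tb _; exact: incident_birth ri ri'.
  - by apply: edge_op_trmul_eq0 => r ri; exact: IHy ri sb.
have xi0 : xi (mxtens_index (r, k)) 0 = 0.
  apply: (span_entry_eq0 xiP) => w; rewrite inE => /predU1P[->|]; first by rewrite mxE.
  move/flattenP => [_ /mapP[s + ->]]; rewrite mem_iota add0n => /andP[_ st].
  have [IHx IHy] := IH s st.
  have sb : (s < birth i k)%N by lia.
  rewrite !inE => /or3P[/eqP->|/eqP->|/eqP->].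
  - exact: IHy ri sb.
  - apply: edge_op_mul_eq0 => i' ri'; apply: edge_op_trmul_eq0 => r' r'i'.
    apply: (IHy _ _ i' r'i'); apply: lt_pred st tb _; exact: incident_birth ri ri'.
  - apply: edge_op_mul_eq0 => i' ri'.
    by apply: IHx; apply: lt_pred st tb _; exact: incident_birth ri ri'.
have zeta0 : zeta (mxtens_index (r, k)) 0 = 0.
  exact: prox_instgbar_eq0 zetaP xi0.
apply: (span_entry_eq0 yt) => w.
by rewrite !inE => /orP[]/eqP->.
Qed.

End Propagation.

(** * Stationary points *)

Section OperatorNorm.
Context {R : realType}.

Lemma norm2_mul_le_opnorm a b (A : 'M[R]_(a, b)) (v : 'cV[R]_b) :
  norm2 v <= 1 -> norm2 (A *m v) <= opnorm A.
Proof.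
move=> v1; rewrite /opnorm; apply: ub_le_sup; last by exists v.
(* Any upper bound serves here: [sup] bounds its set only when the set is bounded above. This one is
   Cauchy-Schwarz on each row. *)
exists (Num.sqrt (\sum_(i < a) b%:R * \sum_(j < b) A i j ^+ 2)) => _ [w /= w1 <-].
rewrite ler_sqrt; last first.
  by apply: sumr_ge0 => i _; rewrite mulr_ge0// sumr_ge0// => j _; exact: sqr_ge0.
apply: ler_sum => i _; rewrite mxE; apply: le_trans (sqr_sum_le _) _.
rewrite ler_wpM2l//; apply: ler_sum => j _; rewrite exprMn ler_piMr ?sqr_ge0//.
by rewrite -(real_normK (num_real _)) expr_le1// (le_trans (coord_le_norm2 _ _)).
Qed.

Lemma opnorm_ge0 a b (A : 'M[R]_(a, b)) : 0 <= opnorm A.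
Proof.
apply: le_trans (norm2_ge0 (A *m 0)) (norm2_mul_le_opnorm _ _).
by rewrite norm2_le// big1// => i _; rewrite mxE expr0n.
Qed.

End OperatorNorm.

Lemma telescope_edges (R : realType) n (f : 'I_n -> R) (i i0 : 'I_n) :
  val i0 = 0%N -> \sum_(e < n.-1 | (e < i)%N) (f (dst e) - f (src e)) = f i - f i0.
Proof.
move=> i00; pose F j := if insub j is Some l then f l else 0.
have FE (j : 'I_n) : F j = f j by rewrite /F valK.
rewrite (eq_bigr (fun e : 'I_n.-1 => F e.+1 - F e)); last first.
  by move=> e _; rewrite -(FE (dst e)) -(FE (src e)).
have ile : (i <= n.-1)%N by have := ltn_ord i; lia.
rewrite -(big_ord_widen _ (fun e => F e.+1 - F e) ile).
by rewrite -(big_mkord xpredT (fun e => F e.+1 - F e)) telescope_sumr// FE -i00 FE.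
Qed.

Section Stationarity.
Context {R : realType}.
Variables (eps Lf beta : R) (m1 m2 dbar : nat).
Hypotheses (Lf_gt0 : 0 < Lf) (m1_gt1 : (1 < m1)%N) (m2_gt0 : (0 < m2)%N).
Hypothesis dbar_gt0 : (0 < dbar)%N.
Local Notation m := (mm m1 m2).
Local Notation p := (m1 * m2)%N.
Local Notation P := (instP eps Lf beta m1 m2 dbar).
Local Notation c := (m%:R * Lf).
Local Notation Abar := (instAbar Lf m1 m2 dbar).
Local Notation A := (instA Lf m1 m2 dbar).
Local Notation sb := (scaled_block eps Lf).

Let m_eq : m = (3 * p)%N. Proof. by rewrite /mm mulnA. Qed.
Let p_gt0 : (0 < p)%N. Proof. by rewrite muln_gt0; lia. Qed.
Let m_gt0 : (0 < m)%N. Proof. by rewrite m_eq; lia. Qed.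
Let M_gt0 : 0 < m%:R :> R. Proof. by rewrite ltr0n. Qed.
Let c_gt0 : 0 < c. Proof. exact: mulr_gt0. Qed.
Let q_gt0 : 0 < Num.sqrt m%:R :> R. Proof. by rewrite sqrtr_gt0. Qed.
Let qq : Num.sqrt m%:R * Num.sqrt m%:R = m%:R :> R.
Proof. by rewrite -expr2 sqr_sqrtr// ltW. Qed.

(** Tested on a basis vector at the source of the first edge. The bound lets the term $\|A\|$ in the
    condition on [beta] absorb the distance [eps] allowed to the subdifferential. *)
Lemma opnorm_instA_ge : c <= opnorm A.
Proof.
have e0 : (0 < m.-1)%N by rewrite m_eq; lia.
pose e := Ordinal e0; pose k := Ordinal dbar_gt0.
(* The edge [e] stands for row 1 of $J_m$, and 1 is not a multiple of [m1] since [m1 > 1]. *)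
have eS : e \in (~: setM m1 m2)%SET.
  rewrite !inE negb_exists; apply/forallP => j; rewrite negb_and -leqNgt orbC.
  by case: (val j) => [|l]; rewrite ?leqnn ?orbT//= mulSn; apply/orP; left; lia.
pose r := enum_rank_in eS e.
have re : enum_val r = e by rewrite enum_rankK_in.
pose v : 'cV[R]_(m * dbar) := delta_mx (mxtens_index (src e, k)) 0.
have v1 : norm2 v <= 1.
  rewrite norm2_le// (bigD1 (mxtens_index (src e, k)))//= big1 ?addr0.
    by rewrite mxE !eqxx.
  by move=> j /negbTE jn; rewrite mxE jn expr0n.
apply: le_trans (norm2_mul_le_opnorm A v1).
apply: le_trans (coord_le_norm2 _ (mxtens_index (r, k))).
rewrite (edge_op_mul Lf v r k) re !mxE !eqxx/= andbT.
rewrite (can_eq (@mxtens_indexK m dbar)) xpair_eqE.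
by rewrite -val_eqE/= sub0r mulrN1 normrN ler_norm.
Qed.

Hypotheses (eps_gt0 : 0 < eps) (dbar_odd : odd dbar).
Hypothesis beta_gt : (50 * pi + 1 + opnorm A) * Num.sqrt m%:R * eps < beta.

Section Point.
Variables (x : 'cV[R]_(m * dbar)) (y z1 : 'cV[R]_(#|setM m1 m2| * dbar)).
Variable z2 : 'cV[R]_(#|(~: setM m1 m2)%SET| * dbar).
Local Notation res := (grad (f0 P) x + (matAbar P)^T *m z1 + (matA P)^T *m z2).
Hypothesis res_le : norm2 res <= eps.

Let dch (i : 'I_m) k := dchain m1 m2 dbar i (sb x i) k.

(** Cauchy-Schwarz over at most $m$ blocks. The residual is written as three separate terms so that
    the prefix and total sums of the multipliers can be evaluated. *)
Lemma sum_res (Q : pred 'I_m) (k : 'I_dbar) :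
  `|\sum_(i < m | Q i) (2 * eps / Num.sqrt m%:R * dch i k
     + (Abar^T *m z1) (mxtens_index (i, k)) 0
     + (A^T *m z2) (mxtens_index (i, k)) 0)| <= Num.sqrt m%:R * eps.
Proof.
have E i : 2 * eps / Num.sqrt m%:R * dch i k
     + (Abar^T *m z1) (mxtens_index (i, k)) 0
     + (A^T *m z2) (mxtens_index (i, k)) 0 = res (mxtens_index (i, k)) 0.
  have addE n (u v : 'cV[R]_n) j : (u + v) j 0 = u j 0 + v j 0 by rewrite !mxE.
  by rewrite !addE [f0 P]/= grad_instf0// out_in_scale.
under eq_bigr do rewrite E.
move: res res_le => w w_le.
have s0 : 0 <= Num.sqrt m%:R * eps by rewrite mulr_ge0// ltW.
rewrite -(ler_pXn2r (_ : 0 < 2)%N) ?nnegrE// real_normK ?num_real//.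
apply: le_trans (sqr_sum_cond_le _ _) _.
rewrite exprMn sqr_sqrtr ?(ltW M_gt0)// ler_pM2l//.
have : norm2 w ^+ 2 <= eps ^+ 2 by rewrite ler_pXn2r ?nnegrE ?norm2_ge0// ltW.
apply: le_trans; rewrite norm2_tens; apply: ler_sum => i _.
by rewrite (bigD1 k)//= lerDl sumr_ge0// => l _; exact: sqr_ge0.
Qed.

(** In the prefix sum up to the edge, [z2] drops out because the edge lies in [setM]. The gradient
    accounts for $(2\epsilon/\sqrt m) \cdot m \cdot 25\pi = 50\pi\sqrt m\,\epsilon$ and the residual
    for $\sqrt m\,\epsilon$. *)
Lemma multiplier_le (r : 'I_#|setM m1 m2|) (k : 'I_dbar) :
  c * `|z1 (mxtens_index (r, k)) 0| <= (50 * pi + 1) * Num.sqrt m%:R * eps.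
Proof.
have := sum_res (fun i => (i <= enum_val r)%N) k.
rewrite !big_split/= edge_op_trmul_prefix sum_enum_val_mem.
rewrite edge_op_trmul_prefix sum_enum_val_notin; last by rewrite inE negbK enum_valP.
rewrite mulr0 oppr0 addr0 -mulr_sumr.
have D : `|\sum_(i < m | (i <= enum_val r)%N) dch i k| <= m%:R * (25 * pi).
  apply: le_trans (ler_norm_sum _ _ _) _.
  rewrite big_mkcond mulr_natl -[m in _ *+ m]card_ord -sumr_const.
  apply: ler_sum => i _; case: ifP => _; first exact: dchain_bound.
  by rewrite mulr_ge0 ?pi_ge0.
have DD : `|2 * eps / Num.sqrt m%:R * \sum_(i < m | (i <= enum_val r)%N) dch i k|
    <= 50 * pi * Num.sqrt m%:R * eps.
  have e0 : 0 <= 2 * eps / Num.sqrt m%:R.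
    by rewrite divr_ge0 ?mulr_ge0 ?(ltW eps_gt0) ?(ltW q_gt0).
  rewrite normrM (ger0_norm e0); apply: le_trans (ler_wpM2l e0 D) _.
  rewrite le_eqVlt; apply/orP; left; apply/eqP.
  move: q_gt0 qq; move: (Num.sqrt _) (@pi R) => q w q0 <-.
  by field; rewrite gt_eqF.
move: DD; move: (_ * \sum_(i < m | _) _) => S DD H.
have cz : c * z1 (mxtens_index (r, k)) 0 = S - (S - c * z1 (mxtens_index (r, k)) 0).
  by rewrite subKr.
rewrite -[X in X * _](gtr0_norm c_gt0) -normrM cz.
apply: le_trans (ler_normB _ _) _; lra.
Qed.

(* A nonzero entry of y would force the same entry of every subgradient to have
   absolute value at least beta / (m Lf), which z1 is too small to match. *)
Lemma stationary_y_eq0 :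
  (dist0 [set (v - z1)%R | v in subdifferential (gbar P) y]%classic <= eps%:E)%E ->
  y = 0.
Proof.
move=> dist_le; apply/matrixP => j j0; rewrite ord1 mxE; apply/eqP/negP => /negP yj.
have A_ge0 := opnorm_ge0 A.
pose y' : 'cV[R]_(#|setM m1 m2| * dbar) := \col_i (if i == j then 0 else y i 0).
have sub v : subdifferential (gbar P) y v -> beta / c <= `|v j 0|.
  move=> /(_ y').
  rewrite /= /instgbar -EFinD lee_fin /norm1 (bigD1 j)//= [X in _ <= _ * X](bigD1 j)//=.
  have -> : \sum_(i < #|setM m1 m2| * dbar | i != j) `|y' i 0| =
      \sum_(i < #|setM m1 m2| * dbar | i != j) `|y i 0|.
    by apply: eq_bigr => i /negbTE ij; rewrite mxE ij.
  have -> : dot v (y' - y) = - (v j 0 * y j 0).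
    rewrite /dot (bigD1 j)//= big1 ?addr0; last first.
      by move=> i /negbTE ij; rewrite !mxE ij subrr mulr0.
    by rewrite !mxE eqxx sub0r mulrN.
  rewrite mxE eqxx normr0 add0r mulrDr.
  move: (_ * \sum_(i < _ | _) _) => S H.
  have {}H : beta / c * `|y j 0| <= v j 0 * y j 0 by lra.
  rewrite -(ler_pM2r (_ : 0 < `|y j 0|)) ?normr_gt0//.
  by apply: le_trans H _; rewrite -normrM ler_norm.
have lb : ((beta / c - `|z1 j 0|)%:E <= eps%:E)%E.
  apply: le_trans dist_le; apply: le_ereal_inf_tmp => _ [_ [v /sub vj <-] <-].
  rewrite lee_fin; apply: le_trans (coord_le_norm2 _ j); rewrite subcE.
  by apply: le_trans (lerB_dist _ _); rewrite lerB.
rewrite lee_fin in lb.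
have zj : c * `|z1 j 0| <= (50 * pi + 1) * Num.sqrt m%:R * eps.
  by case: (mxtens_indexP j) => r k; exact: multiplier_le.
have q1 : 1 <= Num.sqrt m%:R :> R by rewrite -[leLHS]sqrtr1 ler_sqrt ?ler1n.
(* With this, $mL_f$ times the sum of [eps] and the multiplier is at most the threshold that [beta]
   exceeds. *)
have ceps : c * eps <= opnorm A * Num.sqrt m%:R * eps.
  by rewrite ler_pM2r//; apply: le_trans opnorm_instA_ge _; rewrite ler_peMr.
have : beta <= c * (eps + `|z1 j 0|).
  by rewrite -ler_pdivrMl// [c^-1 * _]mulrC -lerBlDr.
rewrite mulrDr; move: beta_gt zj ceps; rewrite !mulrDl; lra.
Qed.

(** The difference to the first block telescopes along the path. Cauchy-Schwarz over the edges and
    the feasibility bounds give $\sqrt 2/(150\pi)$ after scaling. *)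
Lemma consensus_dist (i i0 : 'I_m) (k : 'I_dbar) : val i0 = 0%N ->
  norm2 (Abar *m x) <= eps -> norm2 (A *m x) <= eps ->
  `|sb x i k - sb x i0 k| <= 1 / 5.
Proof.
move=> i00 n1 n2; rewrite !scaled_blockE -mulrBr.
have N : c ^+ 2 * \sum_(e < m.-1) (x (mxtens_index (dst e, k)) 0
      - x (mxtens_index (src e, k)) 0) ^+ 2 <= 2 * eps ^+ 2.
  have sq n (v : 'cV[R]_n) : norm2 v <= eps -> norm2 v ^+ 2 <= eps ^+ 2.
    by move=> ve; rewrite ler_pXn2r ?nnegrE ?norm2_ge0// ltW.
  have : norm2 (Abar *m x) ^+ 2 + norm2 (A *m x) ^+ 2 <= 2 * eps ^+ 2.
    by have := sq _ _ n1; have := sq _ _ n2; lra.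
  apply: le_trans; rewrite [leRHS](edge_op_norm Lf (setM m1 m2) x).
  rewrite ler_pM2l ?exprn_gt0//; apply: ler_sum => e _.
  by rewrite [leRHS](bigD1 k)//= lerDl sumr_ge0// => l _; exact: sqr_ge0.
rewrite -(telescope_edges (fun i => x (mxtens_index (i, k)) 0) i i00).
have r5 : 0 <= 1 / 5 :> R by rewrite divr_ge0.
rewrite -(ler_pXn2r (_ : 0 < 2)%N) ?nnegrE// real_normK ?num_real//.
rewrite exprMn; set s := in_scale _ _ _ _.
have S : (\sum_(e < m.-1 | (e < i)%N) (x (mxtens_index (dst e, k)) 0
      - x (mxtens_index (src e, k)) 0)) ^+ 2 <= m%:R * (2 * eps ^+ 2 / c ^+ 2).
  apply: le_trans (sqr_sum_cond_le _ _) _.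
  apply: ler_pM => //; first by apply: sumr_ge0 => e _; exact: sqr_ge0.
    by rewrite ler_nat leq_pred.
  by rewrite ler_pdivlMr ?exprn_gt0// mulrC.
apply: le_trans (ler_wpM2l (sqr_ge0 _) S) _.
have w2 := @pi_ge2 R.
have -> : s ^+ 2 * (m%:R * (2 * eps ^+ 2 / c ^+ 2)) = 2 / (150 * pi) ^+ 2.
  rewrite /s /in_scale; move: q_gt0 w2 qq.
  move: (Num.sqrt _) (@pi R) => q w q0 w2 <-; field.
  by rewrite !gt_eqF//; lra.
have w0 : 0 < (150 * pi : R) ^+ 2 by rewrite exprn_gt0// mulr_gt0 ?pi_gt0.
rewrite ler_pdivrMr//; move: w2 w0; move: (@pi R) => w w2 w0; nra.
Qed.

(** Over all blocks the multipliers cancel, leaving $(2\epsilon/\sqrt m)\,|\sum_i d_i| \le \sqrt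
    m\,\epsilon$ for the entries $d_i$ of [dch] at [k]. *)
Lemma sum_dchain_ge (k : 'I_dbar) : - (m%:R / 2) <= \sum_(i < m) dch i k.
Proof.
have := sum_res xpredT k; move: dch => d; rewrite !big_split/= !edge_op_trmul_total !addr0
  -mulr_sumr.
move: (\sum_(i < m) _) => S; rewrite ler_norml => /andP[+ _].
move: q_gt0 qq eps_gt0; move: (Num.sqrt _) => q q0 <- e0 H.
have f0 : 0 <= q / (2 * eps) by rewrite ltW// divr_gt0// mulr_gt0.
have := ler_wpM2l f0 H.
have -> : q / (2 * eps) * (2 * eps / q * S) = S by field; rewrite !gt_eqF.
by have -> : q / (2 * eps) * - (q * eps) = - (q * q / 2) by field; rewrite gt_eqF.
Qed.

(* If the last coordinate of the first block vanishes, let k be its first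
   coordinate of absolute value below 1: since the blocks nearly agree, the
   k-th coordinate of the averaged gradient is too negative. *)
Lemma stationary_last_coordinate (i0 : 'I_m) (kl : 'I_dbar) : val i0 = 0%N ->
  norm2 (Abar *m x) <= eps -> norm2 (A *m x) <= eps ->
  x (mxtens_index (i0, kl)) 0 <> 0.
Proof.
move=> i00 n1 n2 x0.
have close i (k : 'I_dbar) := consensus_dist i k i00 n1 n2.
have ex : exists k, (k < dbar)%N && (`|sb x i0 k| < 1).
  by exists kl; rewrite ltn_ord scaled_blockE x0 mulr0 normr0 ltr01.
case: (ex_minnP ex) => k /andP[kd wk] kmin.
have ub i : `|sb x i k| <= 6 / 5.
  have := close i (Ordinal kd); rewrite /= => ci.
  have := ler_normD (sb x i k - sb x i0 k) (sb x i0 k); rewrite subrK; lra.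
have sumge := sum_dchain_ge (Ordinal kd); rewrite /= in sumge.
have M0 := M_gt0.
suff : \sum_(i < m) dch i k <= - (3 / 5 * m%:R) by lra.
clear sumge; case: k kd wk kmin ub => [|k] kd wk kmin ub.
  have -> : - (3 / 5 * m%:R) = \sum_(i < m) - (3 / 5) :> R.
    by rewrite sumr_const card_ord -[RHS]mulr_natr mulNr.
  by apply: ler_sum => i _; exact: dchain_head_le.
have kd' : (k < dbar)%N by exact: ltnW.
have lb i : 4 / 5 <= `|sb x i k|.
  have : 1 <= `|sb x i0 k|.
    by rewrite leNgt; apply/negP => wk'; have := kmin k; rewrite kd' wk' ltnn => /(_ isT).
  have := close i (Ordinal kd'); rewrite /= distrC => ci.
  have := ler_normD (sb x i0 k - sb x i k) (sb x i k); rewrite subrK; lra.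
(* [Q] is the third of the path where the link leaving [k] is active. Its $m/3$ blocks contribute at
   most $-9/5$ each and all others at most 0, for a total of $-3m/5$. *)
have [Q Qc Qcoef] : exists2 Q : pred 'I_m,
    (\sum_(i < m | Q i) 1 = p)%N & forall i, Q i -> coef m1 m2 dbar i k = 3 :> R.
  case: (boolP (odd k)) => ok.
    exists (fun i : 'I_m => ~~ (i < 2 * p)%N) => [|i]; last first.
      by rewrite -leqNgt /coef kd ok => ->; rewrite andbF.
    have : (\sum_(i < m) 1 = m)%N by rewrite sum1_card card_ord.
    have lem : (2 * p <= m)%N by rewrite m_eq leq_mul2r orbT.
    rewrite (bigID (fun i : 'I_m => (i < 2 * p)%N))/=.
    rewrite -(big_ord_widen _ (fun=> 1%N) lem) sum1_card card_ord.
    by rewrite m_eq -[3%N]/(2 + 1)%N mulnDl mul1n => /addnI.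
  exists (fun i : 'I_m => (i < p)%N) => [|i ip]; last by rewrite /coef kd ip ok.
  have lem : (p <= m)%N by rewrite m_eq leq_pmull.
  by rewrite -(big_ord_widen _ (fun=> 1%N) lem) sum1_card card_ord.
apply: (@le_trans _ _ (\sum_(i < m | Q i) - (9 / 5))).
  rewrite [leRHS]big_mkcond; apply: ler_sum => i _.
  case: ifP => [/Qcoef ci|_]; last exact: dchain_le0.
  exact: dchain_link_le.
by rewrite sumr_const -sum1_card Qc -[_ *+ p]mulr_natr m_eq natrM; lra.
Qed.

End Point.

Lemma stationary_coordinate_neq0 x y (i0 : 'I_m) (kl : 'I_dbar) :
  val i0 = 0%N -> eps_stationary eps P x y -> x (mxtens_index (i0, kl)) 0 <> 0.
Proof.
move=> i00 [z1 [z2 [d1 d2 d3 d4]]].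
have y0 := stationary_y_eq0 d2 d1.
apply: (stationary_last_coordinate d2) => //.
  move: d3; rewrite y0 /= sub0r subr0; congr (_ <= _); rewrite /norm2; congr Num.sqrt.
  by move: (_ *m x) => w; apply: eq_bigr => i _; rewrite [in LHS]mxE sqrrN.
by move: d4; rewrite /= addr0.
Qed.


End Stationarity.

(** * The oracle count in terms of the condition number and the objective gap *)

(** With $q = m/3$ and $a = \bar d-1$ the bounds on [kappaSP] and [DeltaF] multiply out to
    $(2/5)q(a+1)$, which is at most $qa$ because $a \ge 1$. *)
Lemma instP_bound_le (R : realType) (eps Lf beta : R) (m1 m2 dbar : nat) :
  0 < eps -> 0 < Lf -> 0 <= beta -> (0 < mm m1 m2)%N -> (2 <= dbar)%N -> odd dbar ->
  kappaSP (instP eps Lf beta m1 m2 dbar) * Lf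
    * DeltaF (instP eps Lf beta m1 m2 dbar) 0 0
    / (72 * 10 ^+ 3 * pi ^+ 2) * eps ^- 2 <= (dbar.-1 * (m1 * m2))%:R.
Proof.
move=> eps0 Lf0 beta0 m0 d2 d_odd; set P := instP _ _ _ _ _ _.
have d0 : (0 < dbar)%N by exact: ltnW.
have k2 : kappaSP P <= 2 * (mm m1 m2)%:R by exact: kappa_stacked_le.
have k0 : 0 <= kappaSP P by exact: sqrtr_ge0.
have D := DeltaF_instP_le eps0 Lf0 beta0 m0 d0 d_odd.
have w0 := @pi_gt0 R.
have pq : 0 <= (m1 * m2)%:R :> R by exact: ler0n.
have dR : dbar%:R = dbar.-1%:R + 1 :> R by rewrite natr1 prednK.
have d1 : 1 <= dbar.-1%:R :> R by rewrite ler1n -ltnS prednK.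
rewrite -mulrA natrM.
move: k2 k0 D; move: (kappaSP P) (DeltaF P 0 0) => k D k2 k0 DB.
have mE : (mm m1 m2)%:R = 3 * (m1 * m2)%:R :> R by rewrite /mm -mulnA natrM.
rewrite mE dR in k2 DB.
move: w0 pq d1 k2 DB; move: (@pi R) (m1 * m2)%:R (dbar.-1)%:R => w q a w0 q0 a1 k2 DB.
have C0 : 0 <= (72 * 10 ^+ 3 * w ^+ 2)^-1 * eps ^- 2.
  apply: mulr_ge0; last by rewrite invr_ge0 exprn_ge0// ltW.
  rewrite invr_ge0; apply: mulr_ge0; last exact: exprn_ge0 (ltW w0).
  by apply: mulr_ge0; [exact: ler0n|apply: exprn_ge0; exact: ler0n].
apply: (@le_trans _ _ (2 * (3 * q) * Lf * (4800 * w ^+ 2 * eps ^+ 2 * (a + 1) / Lf)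
    * ((72 * 10 ^+ 3 * w ^+ 2)^-1 * eps ^- 2))).
  apply: ler_wpM2r => //.
  apply: (@le_trans _ _ (k * Lf * (4800 * w ^+ 2 * eps ^+ 2 * (a + 1) / Lf))).
    by rewrite ler_wpM2l// mulr_ge0// ltW.
  apply: ler_wpM2r; last by rewrite ler_wpM2r// ltW.
  apply: divr_ge0; last exact: ltW.
  apply: mulr_ge0; last by lra.
  apply: mulr_ge0; last exact: exprn_ge0 (ltW eps0).
  by apply: mulr_ge0; [exact: ler0n|exact: exprn_ge0 (ltW w0)].
have -> : 2 * (3 * q) * Lf * (4800 * w ^+ 2 * eps ^+ 2 * (a + 1) / Lf)
    * ((72 * 10 ^+ 3 * w ^+ 2)^-1 * eps ^- 2) = 2 / 5 * q * (a + 1).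
  by field; rewrite !gt_eqF.
nra.
Qed.

Theorem theorem3p1 (R : realType) (eps Lf : R) (heps : 0 < eps) (hLf : 0 < Lf)
    (alg : algorithm R)
    (start : forall d n nbar : nat, 'cV[R]_d * 'cV[R]_nbar)
    (hstart : forall (d n nbar : nat) (P : SP R d n nbar),
        alg d n nbar P 0%N = start d n nbar)
    (hspan : forall (d n nbar : nat) (P : SP R d n nbar),
        assumption1ac Lf P -> (-oo < infF P)%E ->
        assumption3_from_start P
          (fun t => (alg d n nbar P t).1) (fun t => (alg d n nbar P t).2))
    (m1 m2 dbar : nat) (hm1 : (2 <= m1)%N) (hm1even : ~~ odd m1)
    (hm2 : (1 <= m2)%N) (hdbar : (5 <= dbar)%N) (hdbarodd : odd dbar)
    (beta : R)
    (hbeta : (50 * pi + 1 + opnorm (instA Lf m1 m2 dbar))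
               * Num.sqrt (mm m1 m2)%:R * eps < beta) :
  exists P : SP R (mm m1 m2 * dbar) (#|~: setM m1 m2| * dbar)
                  (#|setM m1 m2| * dbar),
    let x t := (alg _ _ _ P t).1 in
    let y t := (alg _ _ _ P t).2 in
    [/\ P = translate (instP eps Lf beta m1 m2 dbar) (x 0%N) (y 0%N),
        assumption1ac Lf P,
        (-oo < infF P)%E
      & forall t : nat, eps_stationary eps P (x t) (y t) ->
          Num.ceil (kappaSP P * Lf * DeltaF P (x 0%N) (y 0%N)
                    / (72 * 10 ^+ 3 * pi ^+ 2) * eps ^- 2) <= t%:Z].
Proof.
have m_eq : mm m1 m2 = (3 * (m1 * m2))%N by rewrite /mm mulnA.
have m_gt0 : (0 < mm m1 m2)%N by rewrite m_eq !muln_gt0 hm2 andbT (ltnW hm1).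
have d_gt0 : (0 < dbar)%N by exact: leq_trans hdbar.
have beta_ge0 : 0 <= beta.
  apply: ltW; apply: le_lt_trans hbeta.
  rewrite mulr_ge0 ?(ltW heps)// mulr_ge0 ?sqrtr_ge0// addr_ge0//.
    by rewrite addr_ge0// mulr_ge0 ?pi_ge0.
  exact: opnorm_ge0.
pose Q := instP eps Lf beta m1 m2 dbar.
(* The starting point depends on the dimensions only, so it is known before the instance is
   translated to it. *)
case sE : (start (mm m1 m2 * dbar)%N (#|~: setM m1 m2| * dbar)%N (#|setM m1 m2| * dbar)%N)
  => [u v].
pose P := translate Q u v.
have st : alg _ _ _ P 0%N = (u, v) by rewrite hstart sE.
have P1 : assumption1ac Lf P by apply: assumption1ac_translate; exact: assumption1ac_instP.
have Pinf : (-oo < infF P)%E.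
  by rewrite infF_translate; apply: lt_le_trans (infF_instP_ge _ _ _ _ _ _); rewrite ?ltNyr.
exists P; rewrite /= st; split=> //= t /eps_stationary_translate stat.
pose x s := (alg _ _ _ P s).1 - u; pose y s := (alg _ _ _ P s).2 - v.
have span : assumption3 Q x y.
  have := hspan _ _ _ P P1 Pinf; rewrite /assumption3_from_start st/=.
  by rewrite translateK.
have x0 : x 0%N = 0 by rewrite /x st subrr.
have y0 : y 0%N = 0 by rewrite /y st subrr.
pose i0 := Ordinal m_gt0.
have dm : (dbar.-1 < dbar)%N by rewrite prednK.
have := stationary_coordinate_neq0 hLf hm1 hm2 d_gt0 heps hdbarodd hbeta
  (i0 := i0) (kl := Ordinal dm) erefl stat.
have [zero _] := iterate_eq0 heps hLf beta_ge0 m_gt0 d_gt0 hdbarodd x0 y0 span t.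
(* Before its birth the last coordinate of the first block is 0, against stationarity; hence [t] is
   at least that birth. *)
have [tb|tb _] := ltnP t (birth m1 m2 i0 dbar.-1); first by case; exact: zero.
rewrite ceil_le_int DeltaF_translate.
apply: le_trans (instP_bound_le heps hLf beta_ge0 m_gt0 _ hdbarodd) _.
  exact: leq_trans hdbar.
rewrite -pmulrn ler_nat; apply: leq_trans tb.
by rewrite birth_first_block// -oddS prednK.
Qed.
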